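(* Let $S$ be a fixed sample graph with $p$ nodes. Suppose the node set of $S$ can be partitioned into the node sets of node-disjoint subgraphs of $S$, consisting of $q$ isolated (single) nodes, pairs of nodes connected by an edge, and graphs that contain an odd-length Hamilton cycle (a cycle of odd length through all nodes of that subgraph, possibly with additional edges among its nodes); $S$ may additionally have edges that connect nodes in two different subgraphs of the decomposition. Then $S$ has a $\bigl(q,(p-q)/2\bigr)$-algorithm, i.e., there is a serial algorithm that, given any data graph $G$ with $n$ nodes and $m$ edges, enumerates all instances of $S$ in $G$, each exactly once, in time $O\bigl(n^{q}m^{(p-q)/2}\bigr)$.
   Context: Graphs are finite, simple and undirected. The sample graph $S$ is fixed, and constants hidden in $O(\cdot)$ may depend on $S$ (and $p$) but not on the data graph $G$, which has $n$ nodes and $m$ edges. An instance of $S$ in $G$ is a (not necessarily induced) subgraph of $G$ isomorphic to $S$. For $\alpha,\beta\ge 0$, an $(\alpha,\beta)$-algorithm for $S$ is a serial algorithm enumerating each instance of $S$ in $G$ exactly once in running time $O(n^{\alpha}m^{\beta})$. It is assumed that $G$ has been preprocessed with an index that tests in $O(1)$ time whether two given nodes are adjacent, and an index that lists the neighbors of a node in time proportional to its degree; both indexes can be built in $O(m)$ time, and the cost of building them is neglected. *)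

(* Defs.v *)
From HB Require Import structures.
From mathcomp Require Import all_boot all_order all_algebra.
From mathcomp Require Import reals exp.

Set Implicit Arguments.
Unset Strict Implicit.
Unset Printing Implicit Defensive.

Import Order.TTheory GRing.Theory Num.Theory.

(** * Graphs, subgraphs, instances *)

Record sgraph (T : finType) := SGraph {
  adj : rel T;
  adj_sym : symmetric adj;
  adj_irr : irreflexive adj
}.

Definition edges (T : finType) (G : sgraph T) : {set {set T}} :=
  [set [set x; y] | x in T, y in T & adj G x y].

Lemma edgesP (T : finType) (G : sgraph T) (A : {set T}) :
  reflect (exists x y, adj G x y /\ A = [set x; y]) (A \in edges G).
Proof.
apply: (iffP imset2P) => [[x y _]|[x [y [xy ->]]]].
  by rewrite inE => /andP[_ xy] ->; exists x, y.
by exists x y => //; rewrite inE xy andbT.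
Qed.

(* A node set together with a set of edges; edges are two-element sets. *)
Definition subgraph (T : finType) : Type := ({set T} * {set {set T}})%type.

Definition is_subgraph (T : finType) (H : subgraph T) (G : sgraph T) : Prop :=
  H.2 \subset edges G /\ (forall A, A \in H.2 -> A \subset H.1).

Definition isomorphic (T U : finType) (S : sgraph T) (H : subgraph U) : Prop :=
  exists f : T -> U,
    [/\ injective f,
        f @: [set: T] = H.1
      & forall x y, adj S x y = ([set f x; f y] \in H.2)].

(* Not necessarily induced. *)
Definition is_instance (T U : finType) (S : sgraph T) (G : sgraph U)
    (H : subgraph U) : Prop :=
  is_subgraph H G /\ isomorphic S H.

(** * Decompositions *)

Definition edge_block (T : finType) (S : sgraph T) (B : {set T}) : Prop :=
  exists x y, adj S x y /\ B = [set x; y].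

Definition odd_hamiltonian_block (T : finType) (S : sgraph T) (B : {set T}) :
    Prop :=
  exists s : seq T,
    [/\ (2 < size s)%N, odd (size s), ucycle (adj S) s & B = [set:: s]].

(* Blocks are node sets of subgraphs of [S]; edges of [S] between different
   blocks, and further edges inside a block, are unrestricted. *)
Definition odd_decomposition (T : finType) (S : sgraph T)
    (P : {set {set T}}) (q : nat) : Prop :=
  [/\ partition P [set: T],
      (forall B, B \in P ->
         [\/ #|B| = 1%N, edge_block S B | odd_hamiltonian_block S B])
    & #|[set B in P | #|B| == 1%N]| = q].

(** * Access to the data graph

   The nodes of a data graph are [0, ..., n-1].  The input is its list of nodes
   and its list of edges, each edge once and in an arbitrary orientation; the
   neighbour index gives a list of neighbours for each node.  The order of
   these lists is arbitrary, so an algorithm has to cope with every order. *)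

Record graph_index (n : nat) (G : sgraph 'I_n) := GraphIndex {
  edge_list : seq ('I_n * 'I_n);
  nbr_list : 'I_n -> seq 'I_n;
  edge_list_uniq : uniq [seq [set e.1; e.2] | e <- edge_list];
  edge_listE : [seq [set e.1; e.2] | e <- edge_list] =i edges G;
  nbr_list_uniq : forall v, uniq (nbr_list v);
  nbr_listE : forall v w, (w \in nbr_list v) = adj G v w
}.

(* The machine handles natural numbers; a query about a number that is not a
   node answers "not adjacent", resp. lists nothing. *)
Definition adj_query (n : nat) (G : sgraph 'I_n) (u v : nat) : bool :=
  if insub u is Some i then
    if insub v is Some j then adj G i j else false
  else false.

Definition nbr_query (n : nat) (G : sgraph 'I_n) (I : graph_index G) (u : nat) :
    seq nat :=
  if insub u is Some i then map val (nbr_list I i) else [::].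

(** * Serial algorithms

   Programs of a random access machine with unit-cost instructions, in
   structured form.  Registers and memory cells are addressed by, and contain,
   natural numbers.  The arithmetic is restricted to addition and truncated
   subtraction: unit-cost multiplication would make the machine unrealistically
   powerful. *)

Definition reg := nat.

Inductive test :=
  | TLt of reg & reg
  | TEq of reg & reg
  | TAdj of reg & reg.

Inductive cmd :=
  | Skip
  | Const of reg & nat
  | Copy of reg & reg
  | Add of reg & reg & reg
  | Sub of reg & reg & reg
  | Read of reg & reg           (* x := memory[y] *)
  | Write of reg & reg          (* memory[x] := y *)
  | Seq of cmd & cmd
  | If of test & cmd & cmd
  | While of test & cmd
  | ForNode of reg & cmd        (* for x in nodes *)
  | ForEdge of reg & reg & cmd  (* for (x, y) in edges *)
  | ForNbr of reg & reg & cmd   (* for x in neighbours of y *)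
  | Emit of seq reg & seq (reg * reg).

Record state := State { regs : nat -> nat; mem : nat -> nat }.

Definition init_state : state := State (fun=> 0%N) (fun=> 0%N).

Definition upd (f : nat -> nat) (a v : nat) : nat -> nat :=
  fun b => if b == a then v else f b.

Definition set_reg (s : state) (x : reg) (v : nat) : state :=
  State (upd (regs s) x v) (mem s).

Definition set_mem (s : state) (a v : nat) : state :=
  State (regs s) (upd (mem s) a v).

Section Semantics.

Variables (n : nat) (G : sgraph 'I_n) (I : graph_index G).

(* [r s t o s']: from state [s], a run of [t] steps that outputs the
   subgraphs [o], in this order, and ends in state [s']. *)
Definition runs : Type :=
  state -> nat -> seq (subgraph 'I_n) -> state -> Prop.

Definition eval_test (b : test) (s : state) : bool :=
  match b with
  | TLt x y => (regs s x < regs s y)%N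
  | TEq x y => regs s x == regs s y
  | TAdj x y => adj_query G (regs s x) (regs s y)
  end.

Inductive run_while (b : test) (body : runs) : runs :=
  | run_while_false s : ~~ eval_test b s -> run_while b body s 1 [::] s
  | run_while_true s t1 o1 s1 t2 o2 s2 :
      eval_test b s -> body s t1 o1 s1 -> run_while b body s1 t2 o2 s2 ->
      run_while b body s (t1 + t2).+1 (o1 ++ o2) s2.

(* Fetching the next element of a list takes one step, as does noticing that
   the list is exhausted. *)
Inductive run_for (A : Type) (bind : state -> A -> state) (body : runs) :
    seq A -> runs :=
  | run_for_nil s : run_for bind body [::] s 1 [::] s
  | run_for_cons a l s t1 o1 s1 t2 o2 s2 :
      body (bind s a) t1 o1 s1 -> run_for bind body l s1 t2 o2 s2 ->
      run_for bind body (a :: l) s (t1 + t2).+1 (o1 ++ o2) s2.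

Definition run_basic (s0 : state) : runs :=
  fun s t o s' => [/\ t = 1%N, o = [::] & s' = s0].

(* The program is stuck if a listed register does not contain a node. *)
Definition run_emit (xs : seq reg) (es : seq (reg * reg)) : runs :=
  fun s t o s' =>
    exists (vs : seq 'I_n) (ps : seq ('I_n * 'I_n)),
      [/\ map val vs = map (regs s) xs,
          [seq (val p.1, val p.2) | p <- ps]
            = [seq (regs s e.1, regs s e.2) | e <- es],
          o = [:: ([set:: vs], [set [set p.1; p.2] | p in ps])],
          t = (1 + size xs + size es)%N
        & s' = s].

Fixpoint exec (c : cmd) : runs :=
  fun s t o s' =>
  let rg := regs s in
  match c with
  | Skip => run_basic s s t o s'
  | Const x k => run_basic (set_reg s x k) s t o s'
  | Copy x y => run_basic (set_reg s x (rg y)) s t o s'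
  | Add x y z => run_basic (set_reg s x (rg y + rg z)) s t o s'
  | Sub x y z => run_basic (set_reg s x (rg y - rg z)) s t o s'
  | Read x y => run_basic (set_reg s x (mem s (rg y))) s t o s'
  | Write x y => run_basic (set_mem s (rg x) (rg y)) s t o s'
  | Seq c1 c2 =>
      exists t1 o1 s1 t2 o2,
        [/\ exec c1 s t1 o1 s1, exec c2 s1 t2 o2 s',
            t = (t1 + t2)%N & o = o1 ++ o2]
  | If b c1 c2 =>
      exists2 t1, t = t1.+1 &
        if eval_test b s then exec c1 s t1 o s' else exec c2 s t1 o s'
  | While b c1 => run_while b (exec c1) s t o s'
  | ForNode x c1 =>
      run_for (fun s1 v => set_reg s1 x v) (exec c1) (iota 0 n) s t o s'
  | ForEdge x y c1 =>
      run_for (fun s1 (e : 'I_n * 'I_n) =>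
                 set_reg (set_reg s1 x (val e.1)) y (val e.2))
        (exec c1) (edge_list I) s t o s'
  | ForNbr x y c1 =>
      run_for (fun s1 v => set_reg s1 x v) (exec c1) (nbr_query I (rg y))
        s t o s'
  | Emit xs es => run_emit xs es s t o s'
  end.

Let det (r : runs) : Prop := forall s t o s' t1 o1 s1,
  r s t o s' -> r s t1 o1 s1 -> [/\ t = t1, o = o1 & s' = s1].

Let det_while b r : det r -> det (run_while b r).
Proof.
move=> dr s t o s' t1 o1 s1 H; elim: H t1 o1 s1 => {s t o s'}.
  move=> s nb t1 o1 s1 H; inversion H as [|? ? ? ? ? ? ? e]; subst => //.
  by rewrite e in nb.
move=> s ta oa sa tb ob sb eb Ha _ IH t1 o1 s1 H.
inversion H as [? nb|? ? ? ? ? ? ? ? Ha' Hb']; subst.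
  by rewrite eb in nb.
have [? ? ?] := dr _ _ _ _ _ _ _ Ha Ha'; subst.
by have [-> -> ->] := IH _ _ _ Hb'.
Qed.

Let det_for A (bind : state -> A -> state) r l :
  det r -> det (run_for bind r l).
Proof.
move=> dr s t o s' t1 o1 s1 H; elim: H t1 o1 s1 => {l s t o s'}.
  by move=> s t1 o1 s1 H; inversion H.
move=> a l s ta oa sa tb ob sb Ha _ IH t1 o1 s1 H.
inversion H as [|? ? ? ? ? ? ? ? ? Ha' Hb']; subst.
have [? ? ?] := dr _ _ _ _ _ _ _ Ha Ha'; subst.
by have [-> -> ->] := IH _ _ _ Hb'.
Qed.

Lemma exec_deterministic c s t o s' t1 o1 s1 :
  exec c s t o s' -> exec c s t1 o1 s1 -> [/\ t = t1, o = o1 & s' = s1].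
Proof.
have basic s0 : det (run_basic s0).
  by move=> ? ? ? ? ? ? ? [-> -> ->] [-> -> ->].
suff: det (exec c) by apply.
elim: c => [|x k|x y|x y z|x y z|x y|x y|c1 IH1 c2 IH2|b c1 IH1 c2 IH2|b c1 IH1
  |x c1 IH1|x y c1 IH1|x y c1 IH1|xs es] {s t o s' t1 o1 s1};
  move=> s t o s' t1 o1 s1 /=; try exact: basic.
- move=> [ta [oa [sa [tb [ob [Ha Hb -> ->]]]]]].
  move=> [ta' [oa' [sa' [tb' [ob' [Ha' Hb' -> ->]]]]]].
  have [? ? ?] := IH1 _ _ _ _ _ _ _ Ha Ha'; subst.
  by have [-> -> ->] := IH2 _ _ _ _ _ _ _ Hb Hb'.
- move=> [ta ->] + [tb ->]; case: ifP => _ Ha Hb.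
    by have [-> -> ->] := IH1 _ _ _ _ _ _ _ Ha Hb.
  by have [-> -> ->] := IH2 _ _ _ _ _ _ _ Ha Hb.
- exact: det_while.
- exact: det_for.
- exact: det_for.
- exact: det_for.
- move=> [vs [ps [Ev Ep -> -> ->]]] [vs' [ps' [Ev' Ep' -> -> ->]]].
  have -> : vs = vs' by apply: (inj_map val_inj); rewrite Ev Ev'.
  suff -> : ps = ps' by [].
  have inj2 : injective (fun p : 'I_n * 'I_n => (val p.1, val p.2)).
    by move=> [a b] [a' b'] /= [/val_inj -> /val_inj ->].
  by apply: (inj_map inj2); rewrite Ep Ep'.
Qed.

End Semantics.

(** * (alpha, beta)-algorithms *)

Local Open Scope ring_scope.

(* Even an algorithm with nothing to do takes constant time, whereas
   [n ^ alpha * m ^ beta] is 0 if, for example, [m = 0 < beta]; hence the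
   maximum with 1, which changes nothing when that product is nonzero. *)
Definition has_algorithm (R : realType) (T : finType) (S : sgraph T)
    (alpha beta : R) : Prop :=
  [/\ 0 <= alpha, 0 <= beta
    & exists (prog : cmd) (C : R),
      forall (n : nat) (G : sgraph 'I_n) (I : graph_index G),
        exists (t : nat) (out : seq (subgraph 'I_n)) (s : state),
          [/\ exec I prog init_state t out s,
              uniq out,
              (forall H, H \in out <-> is_instance S G H)
            & t%:R <= C * Num.max 1
                            (n%:R `^ alpha * #|edges G|%:R `^ beta)]].

(* Main.v *)
Require Import Defs.
From mathcomp Require Import all_boot all_order all_fingroup all_algebra.
From mathcomp Require Import reals exp.
From mathcomp Require Import zify ring lra.

Set Implicit Arguments.
Unset Strict Implicit.
Unset Printing Implicit Defensive.

Import Order.TTheory GRing.Theory Num.Theory.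

(**
   Every homomorphic image of [S] is assembled block by block in nested loops:
   a single node costs a loop over the nodes, an edge block a loop over the
   edges.  For a cycle [a, b, ..., z] of odd length [2k+1], let [r] be the
   integer square root of [m].  If [a] is light, that is of degree at most [r],
   loop over the edge [ab], over the neighbour [z] of [a], and over [k-1]
   disjoint edges covering the other nodes; if [a] is heavy, loop over the at
   most [3r] heavy nodes and over [k] disjoint edges covering the rest.  Both
   cost [O(m^(k+1/2))], and together they meet each cycle once.  An innermost
   constant-time test keeps the injective homomorphisms and, among those that
   differ by an automorphism of [S], exactly one, chosen by the relative order
   of the images. *)

(** * Instances as images of embeddings *)

(** The target bound can degenerate, and this dictates the order of the loops. If some block has
    more than one node and the data graph has no edges, only constant time is available, however
    large [n] is. Hence the loops over single nodes go innermost, where an empty edge list keeps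
    them from starting, and the heavy nodes are collected while scanning the edge list, never by a
    pass over all nodes. If all blocks are single nodes, [m] may exceed [n^q] (take [S] a single
    node), so even the linear preprocessing must be left out. Away from these cases the accounting
    is uniform: a step that binds [j] nodes of the larger blocks costs O(m^(j/2)), with [j] = 2 for
    an edge, 3 for a light step and 1 for a heavy one. *)

Lemma mem_edges (U : finType) (G : sgraph U) x y :
  ([set x; y] \in edges G) = adj G x y.
Proof.
apply/edgesP/idP => [[u [v [uv E]]]|xy]; last by exists x, y.
have /set2P[xE|xE] : x \in [set u; v] by rewrite -E set21.
  have /set2P[yE|yE] : y \in [set u; v] by rewrite -E set22.
    have : v \in [set x; y] by rewrite E set22.
    by rewrite xE yE setUid => /set1P vE; rewrite vE adj_irr in uv.
  by rewrite xE yE.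
have /set2P[yE|yE] : y \in [set u; v] by rewrite -E set22.
  by rewrite xE yE adj_sym.
have : u \in [set x; y] by rewrite E set21.
by rewrite xE yE setUid => /set1P vE; rewrite vE adj_irr in uv.
Qed.

Section Embeddings.

Variables (T : finType) (S : sgraph T).

Definition image_subgraph (U : finType) (g : T -> U) : subgraph U :=
  (g @: [set: T],
   [set [set g e.1; g e.2] | e in [set e : T * T | adj S e.1 e.2]]).

Definition embedding (U : finType) (G : sgraph U) (g : T -> U) : Prop :=
  injective g /\ forall x y, adj S x y -> adj G (g x) (g y).

Lemma mem_image_subgraph (U : finType) (g : T -> U) x y :
  injective g -> ([set g x; g y] \in (image_subgraph g).2) = adj S x y.
Proof.
move=> ginj; apply/imsetP/idP => [[[u v] /=]|xy]; last first.
  by exists (x, y); rewrite ?inE.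
rewrite inE /= => uv E; rewrite -mem_edges.
suff -> : [set x; y] = [set u; v] by rewrite mem_edges.
by apply: (imset_inj ginj); rewrite !imsetU1 !imset_set1.
Qed.

(** Each edge of an instance lies inside its node set, so both ends are values of the isomorphism;
    this is why no edge of [H] is missed by the image. *)
Lemma instanceP (U : finType) (G : sgraph U) H :
  is_instance S G H <-> exists2 g, embedding G g & H = image_subgraph g.
Proof.
split=> [[[HG HV] [g [ginj gV gE]]]|[g [ginj gh] ->]].
  exists g.
    by split=> // x y; rewrite gE => /(subsetP HG); rewrite mem_edges.
  case: H => V E /= in HG HV gV gE *; congr pair => //.
  apply/setP => A; apply/idP/imsetP => [AE|[e]]; last first.
    by rewrite inE gE => ? ->.
  have /edgesP[u [v [_ AE']]] := subsetP HG _ AE.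
  have AV := HV _ AE.
  have : u \in V by apply: (subsetP AV); rewrite AE' set21.
  have : v \in V by apply: (subsetP AV); rewrite AE' set22.
  rewrite -gV => /imsetP[y _ vE] /imsetP[x _ uE].
  by exists (x, y); rewrite ?inE /= ?gE -uE -vE -AE'.
split; first split.
- by apply/subsetP=> _ /imsetP[e + ->]; rewrite inE mem_edges => /gh.
- by move=> _ /imsetP[e _ ->]; rewrite subUset !sub1set !imset_f.
- by exists g; split=> // x y; rewrite mem_image_subgraph.
Qed.

(** * Automorphisms and the choice of one embedding per instance *)

Definition auts : {set {perm T}} :=
  [set u : {perm T} | [forall x, forall y, adj S (u x) (u y) == adj S x y]].

Lemma autsP (u : {perm T}) :
  reflect (forall x y, adj S (u x) (u y) = adj S x y) (u \in auts).
Proof.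
rewrite inE; apply: (iffP forallP) => [H x y|H x].
  by have /forallP/(_ y)/eqP := H x.
by apply/forallP => y; rewrite H.
Qed.

Lemma auts1 : 1%g \in auts.
Proof. by apply/autsP => x y; rewrite !perm1. Qed.

Lemma autsM u v : u \in auts -> v \in auts -> (u * v)%g \in auts.
Proof.
by move=> /autsP uP /autsP vP; apply/autsP => x y; rewrite !permM vP uP.
Qed.

Lemma autsV u : u \in auts -> (u^-1)%g \in auts.
Proof.
move=> /autsP uP; apply/autsP => x y.
by rewrite -uP -!permM !mulVg !perm1.
Qed.

Lemma image_subgraph_aut (U : finType) (g : T -> U) (u : {perm T}) :
  u \in auts -> image_subgraph (g \o u) = image_subgraph g.
Proof.
move=> /autsP uP; congr pair.
  apply/setP => i; apply/imsetP/imsetP => -[t _ ->]; first by exists (u t).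
  by exists ((u^-1)%g t); rewrite //= -permM mulVg perm1.
apply/setP => A; apply/imsetP/imsetP => -[[x y]]; rewrite inE /= => xy ->.
  by exists (u x, u y); rewrite // inE uP.
exists ((u^-1)%g x, (u^-1)%g y); rewrite /= -?permM ?mulVg ?perm1 //.
by rewrite inE /= -uP -!permM !mulVg !perm1.
Qed.

(** The automorphism is [g] followed by the inverse of [h]: both maps have the same node image, and
    adjacency in [S] is read off the same edge set through either of them. *)
Lemma eq_image_subgraph (U : finType) (g h : T -> U) :
  injective g -> injective h -> image_subgraph g = image_subgraph h ->
  exists2 u, u \in auts & g =1 h \o u.
Proof.
move=> ginj hinj E.
have ex x : exists y, h y == g x.
  have : g x \in (image_subgraph h).1 by rewrite -E imset_f.
  by case/imsetP => y _ ->; exists y.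
pose w x := xchoose (ex x).
have wE x : h (w x) = g x by exact/eqP/(xchooseP (ex x)).
have winj : injective w by move=> x y /(congr1 h); rewrite !wE => /ginj.
exists (perm winj) => [|x]; last by rewrite /= permE wE.
apply/autsP => x y; rewrite !permE -(mem_image_subgraph _ _ hinj) !wE -E.
by rewrite mem_image_subgraph.
Qed.

Definition orbit_of (C : finType) (c : {ffun T -> C}) : {set {ffun T -> C}} :=
  [set [ffun t => c (u t)] | u : {perm T} in auts].

(* [pick] only depends on the orbit as a set, so it selects exactly one element
   of each orbit. *)
Definition canonical (C : finType) (c : {ffun T -> C}) : bool :=
  [pick d in orbit_of c] == Some c.

Lemma orbit_of_aut (C : finType) (c : {ffun T -> C}) u :
  u \in auts -> orbit_of [ffun t => c (u t)] = orbit_of c.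
Proof.
move=> uA; apply/setP => d; apply/imsetP/imsetP => -[v vA ->].
  by exists (v * u)%g; [exact: autsM | apply/ffunP => t; rewrite !ffunE permM].
exists (v * u^-1)%g; first exact: autsM (autsV _).
by apply/ffunP => t; rewrite !ffunE -permM mulgKV.
Qed.

Lemma canonical_exists (C : finType) (c : {ffun T -> C}) :
  exists2 u, u \in auts & canonical [ffun t => c (u t)].
Proof.
have [u uA E] : exists2 u, u \in auts &
    [pick d in orbit_of c] = Some [ffun t => c (u t)].
  case: pickP => [_ /imsetP[u uA ->]|/(_ c)]; first by exists u.
  by rewrite -{1}[c]ffunK; case/negP; apply/imsetP; exists 1%g;
    [exact: auts1 | apply/ffunP => t; rewrite !ffunE perm1].
by exists u => //; rewrite /canonical orbit_of_aut // E.
Qed.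

(** For an injective [c], such as the rank pattern of an embedding, this forces [u] to be the
    identity: only one embedding per instance passes the test. *)
Lemma canonical_unique (C : finType) (c : {ffun T -> C}) u :
  u \in auts -> canonical c -> canonical [ffun t => c (u t)] ->
  forall t, c (u t) = c t.
Proof.
move=> uA; rewrite /canonical orbit_of_aut // => /eqP -> /eqP[/ffunP E] t.
by rewrite [in RHS]E ffunE.
Qed.

(* For a strict total order this is the position of each point. *)
Definition order_rank (lt : rel T) : {ffun T -> 'I_#|T|.+1} :=
  [ffun x => inord #|[set y | lt y x]|].

Definition value_rank (f : T -> nat) := order_rank (fun y x => f y < f x).

Lemma value_rank_inj f : injective f -> injective (value_rank f).
Proof.
have mono x y : f x < f y -> value_rank f x < value_rank f y.
  move=> xy; rewrite !ffunE !inordK ?ltnS ?max_card //.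
  apply/proper_card/properP; split.
    by apply/subsetP => z; rewrite !inE => zx; apply: ltn_trans xy.
  by exists x; rewrite !inE ?ltnn.
move=> finj x y E; apply: finj; case: (ltngtP (f x) (f y)) => // /mono.
  by rewrite E ltnn.
by rewrite E ltnn.
Qed.

(** Composing an embedding with an automorphism moves its rank pattern within its orbit, so choosing
    a pattern in an orbit amounts to choosing an embedding of an instance. *)
Lemma value_rank_perm (f : T -> nat) (u : {perm T}) :
  value_rank (f \o u) = [ffun t => value_rank f (u t)].
Proof.
apply/ffunP => x; rewrite !ffunE; congr inord.
rewrite -(card_imset _ (@perm_inj _ u)); apply: eq_card => y.
rewrite inE; apply/imsetP/idP => [[z + ->]|yx]; first by rewrite inE.
by exists ((u^-1)%g y); rewrite ?inE /= -?permM ?mulVg ?perm1.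
Qed.

End Embeddings.

(** * Edges and degrees in the data graph *)

Section GraphIndex.

Variables (n : nat) (G : sgraph 'I_n) (I : graph_index G).

Lemma size_edge_list : size (edge_list I) = #|edges G|.
Proof.
rewrite -(size_map (fun e => [set e.1; e.2])) -(card_uniqP (edge_list_uniq I)).
exact/eq_card/edge_listE.
Qed.

Lemma edge_list_adj e : e \in edge_list I -> adj G e.1 e.2.
Proof.
by move=> eI; rewrite -mem_edges -(edge_listE I); apply/mapP; exists e.
Qed.

Lemma edge_list_orientation u v :
  adj G u v = ((u, v) \in edge_list I) || ((v, u) \in edge_list I).
Proof.
apply/idP/orP => [uv|[/edge_list_adj|/edge_list_adj]] //=;
  last by rewrite adj_sym.
have : [set u; v] \in edges G by rewrite mem_edges.
rewrite -(edge_listE I) => /mapP[[a b] abI /= E].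
have /set2P[aE|aE] : a \in [set u; v] by rewrite E set21.
  have /set2P[bE|bE] : b \in [set u; v] by rewrite E set22.
    by have := edge_list_adj abI; rewrite /= aE bE adj_irr.
  by left; rewrite -aE -bE.
have /set2P[bE|bE] : b \in [set u; v] by rewrite E set22.
  by right; rewrite -aE -bE.
by have := edge_list_adj abI; rewrite /= aE bE adj_irr.
Qed.

Lemma edge_list_uniq_pairs : uniq (edge_list I).
Proof. exact: map_uniq (edge_list_uniq I). Qed.

(** Uniqueness of the index concerns unordered pairs, so the reversed pair would repeat an edge.
    This keeps the two scans of [edge_code] disjoint. *)
Lemma edge_list_asym u v :
  (u, v) \in edge_list I -> (v, u) \notin edge_list I.
Proof.
move=> uvI; apply/negP => vuI.
have uv := edge_list_adj uvI.
suff [uE] : (u, v) = (v, u) by move: uv; rewrite /= uE adj_irr.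
have inj: {in edge_list I &, injective (fun e : 'I_n * 'I_n => [set e.1; e.2])}.
  elim: (edge_list I) (edge_list_uniq I) => //= e l IH /andP[el lu].
  move=> a b /predU1P[->|al] /predU1P[->|bl] // E.
  - by case/negP: el; rewrite E; apply/mapP; exists b.
  - by case/negP: el; rewrite -E; apply/mapP; exists a.
  - exact: IH.
by apply: inj => //=; rewrite setUC.
Qed.

Definition endpoints (l : seq ('I_n * 'I_n)) : seq nat :=
  flatten [seq [:: val e.1; val e.2] | e <- l].

Lemma size_endpoints l : size (endpoints l) = (size l).*2.
Proof. by elim: l => //= e l ->; rewrite doubleS. Qed.

Lemma endpoints_rcons l e :
  endpoints (rcons l e) = rcons (rcons (endpoints l) (val e.1)) (val e.2).
Proof. by rewrite /endpoints map_rcons flatten_rcons -!cats1 -catA. Qed.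

(** Phrased as occurrences in the edge list, because this is the number that one scan of the list
    accumulates. *)
Definition degree (v : nat) : nat := count_mem v (endpoints (edge_list I)).

Lemma mem_nbr_query u v : (v \in nbr_query I u) = adj_query G u v.
Proof.
rewrite /nbr_query /adj_query; case: insubP => // i _ _.
case: insubP => [j _ <-|vn].
  by rewrite (mem_map val_inj) nbr_listE.
by apply/mapP => -[j _ vE]; rewrite vE ltn_ord in vn.
Qed.

Lemma nbr_query_uniq u : uniq (nbr_query I u).
Proof.
rewrite /nbr_query; case: insubP => // i _ _.
by rewrite map_inj_uniq ?nbr_list_uniq //; exact: val_inj.
Qed.

Lemma adj_queryP u v :
  reflect (exists i j, [/\ val i = u, val j = v & adj G i j]) (adj_query G u v).
Proof.
apply: (iffP idP) => [|[i [j [<- <- ij]]]]; last by rewrite /adj_query !valK.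
by rewrite /adj_query; do 2![case: insubP => // ? _ <-] => ?; do 2![eexists].
Qed.

(** Each neighbour is the other end of a listed edge at [v], and each such edge contributes an
    occurrence of [v]. *)
Lemma size_nbr_query v : size (nbr_query I v) <= degree v.
Proof.
pose other (e : 'I_n * 'I_n) := if val e.1 == v then val e.2 else val e.1.
pose incident (e : 'I_n * 'I_n) := (val e.1 == v) || (val e.2 == v).
have sub : {subset nbr_query I v <= map other (filter incident (edge_list I))}.
  move=> w; rewrite mem_nbr_query => /adj_queryP[i [j [iv <- ij]]].
  have := ij; rewrite edge_list_orientation => /orP[el|el]; apply/mapP.
    by exists (i, j); rewrite ?mem_filter /incident /other /= -iv ?eqxx.
  exists (j, i); rewrite ?mem_filter /incident /other /= -iv ?eqxx ?orbT //.
  by case: eqP => //= /val_inj ji; rewrite ji adj_irr in ij.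
apply: leq_trans (uniq_leq_size (nbr_query_uniq v) sub) _.
rewrite size_map size_filter /degree; elim: (edge_list I) => //= e l IH.
by rewrite -/(endpoints l) {1}/incident; case: eqP; case: eqP => /= _ _; lia.
Qed.

Lemma degree_gt0_node v r : r < degree v -> v < n.
Proof.
rewrite /degree => /(leq_ltn_trans (leq0n r)).
rewrite -has_count has_pred1 => /flattenP[_ /mapP[e _ ->]].
by rewrite !inE => /orP[] /eqP ->; rewrite ltn_ord.
Qed.

End GraphIndex.

(** Distinct values occupy disjoint sets of more than [r] positions; the induction deletes the
    positions of one value. On the list of edge endpoints, of length [2m], this bounds the number of
    heavy nodes. *)
Lemma size_over_threshold (l hv : seq nat) r :
  uniq hv -> {in hv, forall v, r < count_mem v l} ->
  size hv * r.+1 <= size l.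
Proof.
elim: hv l => [|v hv IH] l //= /andP[vhv hvu] hvr.
have {}IH := IH [seq x <- l | x != v] hvu.
have -> : size l = count_mem v l + size [seq x <- l | x != v].
  by rewrite size_filter -(count_predC (pred1 v)).
rewrite mulSn leq_add ?hvr ?mem_head // IH // => w wh.
rewrite count_filter (eq_count (a2 := pred1 w)) ?hvr ?inE ?wh ?orbT //.
by move=> x /=; case: eqP => //= ->; case: eqP => // E; rewrite -E wh in vhv.
Qed.

(** * Loop programs *)

Local Notation memory := Defs.mem.

Section Programs.

Variable T : finType.

(* Registers 0 to 9 serve as scratch space and as constants; every node [t] of
   the sample graph owns [node_reg t], which holds its image, and a loop
   counter [ctr_reg t]. *)
Definition node_reg (t : T) : reg := (enum_rank t).*2 + 10.
Definition ctr_reg (t : T) : reg := (enum_rank t).*2 + 11.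

Notation tmp := 0.
Notation one := 2.
Notation thr := 3.
Notation top := 4.

Lemma node_reg_eq t u : (node_reg t == node_reg u) = (t == u).
Proof.
rewrite /node_reg eqn_add2r; apply/eqP/eqP => [/double_inj|-> //].
by move=> /val_inj/enum_rank_inj.
Qed.

Lemma ctr_reg_eq t u : (ctr_reg t == ctr_reg u) = (t == u).
Proof.
rewrite /ctr_reg eqn_add2r; apply/eqP/eqP => [/double_inj|-> //].
by move=> /val_inj/enum_rank_inj.
Qed.

Lemma node_ctr_reg t u : (node_reg t == ctr_reg u) = false.
Proof. by rewrite /node_reg /ctr_reg; lia. Qed.

Definition touched (vs : seq T) (z : reg) : bool :=
  (z < 2) || has (fun t => (z == node_reg t) || (z == ctr_reg t)) vs.

Lemma touched_cat vs ws z : touched (vs ++ ws) z = touched vs z || touched ws z.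
Proof. by rewrite /touched has_cat; case: (z < 2). Qed.

Lemma touched_node_reg vs t : touched vs (node_reg t) = (t \in vs).
Proof.
rewrite /touched -has_pred1 (@eq_has _ _ (pred1 t)) => [|u].
  by rewrite /node_reg; case: ltnP => //; lia.
by rewrite node_reg_eq node_ctr_reg orbF eq_sym.
Qed.

Lemma touched_ctr_reg vs t : touched vs (ctr_reg t) = (t \in vs).
Proof.
rewrite /touched -has_pred1 (@eq_has _ _ (pred1 t)) => [|u].
  by rewrite /ctr_reg; case: ltnP => //; lia.
by rewrite ctr_reg_eq eq_sym node_ctr_reg eq_sym.
Qed.

Lemma touched_const vs z : 1 < z < 10 -> touched vs z = false.
Proof.
move=> /andP[z1 z10]; rewrite /touched ltnNge z1 /=.
by apply/hasPn => t _; rewrite /node_reg /ctr_reg; lia.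
Qed.

(* Memory cell [2 v] counts the occurrences of [v] in [l], and the odd cells
   list the values occurring more than [r] times. *)
Definition count_inv (r : nat) (l : seq nat) (s : state) : Prop :=
  [/\ regs s one = 1, regs s thr = r, forall v, memory s v.*2 = count_mem v l
    & exists hv, [/\ uniq hv, forall v, (v \in hv) = (r < count_mem v l),
        regs s top = (size hv).*2.+1
      & forall i, i < size hv -> memory s i.*2.+1 = nth 0 hv i]].

Inductive step :=
  | SNode of T
  | SEdge of T & T
  | SLight of T & T & T  (* an edge [x y], [x] light, and a neighbour of [x] *)
  | SHeavy of T.

Definition step_nodes (st : step) : seq T :=
  match st with
  | SNode x => [:: x]
  | SEdge x y => [:: x; y]
  | SLight x y z => [:: x; y; z]
  | SHeavy x => [:: x]
  end.

(** Both assignments of the ends to [x] and [y] must be tried, while the list holds one orientation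
    of each edge. *)
Definition edge_code (x y : T) (c : cmd) : cmd :=
  Seq (ForEdge (node_reg x) (node_reg y) c)
      (ForEdge (node_reg y) (node_reg x) c).

Definition light_code (x z : T) (c : cmd) : cmd :=
  Seq (Add tmp (node_reg x) (node_reg x))
 (Seq (Read tmp tmp)
      (If (TLt thr tmp) Skip (ForNbr (node_reg z) (node_reg x) c))).

(** The heavy nodes sit in the odd cells 1, 3, 5, ..., whence the start at 1 and the double
    increment. The counter belongs to [x], since heavy loops of different cycles nest. *)
Definition heavy_code (x : T) (c : cmd) : cmd :=
  Seq (Const (ctr_reg x) 1)
      (While (TLt (ctr_reg x) top)
        (Seq (Read (node_reg x) (ctr_reg x))
        (Seq (Add (ctr_reg x) (ctr_reg x) one)
        (Seq (Add (ctr_reg x) (ctr_reg x) one) c)))).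

Definition step_code (st : step) (c : cmd) : cmd :=
  match st with
  | SNode x => ForNode (node_reg x) c
  | SEdge x y => edge_code x y c
  | SLight x y z => edge_code x y (light_code x z c)
  | SHeavy x => heavy_code x c
  end.

Definition needs_degrees (st : step) : bool :=
  match st with SLight _ _ _ | SHeavy _ => true | _ => false end.

(** A common upper bound for all kinds of loop with [w] iterations; each 5 dominates the set-up cost
    and the overhead per iteration. *)
Definition loop_time (w tau : nat) : nat := 5 + w * (tau + 5).

Definition step_time (n m r : nat) (st : step) (tau : nat) : nat :=
  match st with
  | SNode _ => loop_time n tau
  | SEdge _ _ => loop_time m.*2 tau
  | SLight _ _ _ => loop_time m.*2 (loop_time r tau)
  | SHeavy _ => loop_time (3 * r) tau
  end.

Definition plan := seq step.

Definition plan_nodes (p : plan) : seq T := flatten (map step_nodes p).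

Definition plan_code (p : plan) (c : cmd) : cmd := foldr step_code c p.

Definition plan_time (n m r : nat) (p : plan) (tau : nat) : nat :=
  foldr (step_time n m r) tau p.

Definition plans_code (ps : seq plan) (c : cmd) : cmd :=
  foldr (fun p c' => Seq (plan_code p c) c') Skip ps.

(** * Specification of nested loops *)

Section Semantics.

Variables (n : nat) (G : sgraph 'I_n) (I : graph_index G) (r : nat) (b : bool).
Variable out : {ffun T -> nat} -> seq (subgraph 'I_n).

Let m := size (edge_list I).

Definition step_good (st : step) (f : {ffun T -> nat}) : bool :=
  match st with
  | SNode x => f x < n
  | SEdge x y => adj_query G (f x) (f y)
  | SLight x y z =>
      [&& adj_query G (f x) (f y), degree I (f x) <= r
        & adj_query G (f x) (f z)]
  | SHeavy x => r < degree I (f x)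
  end.

Definition degrees_ready (s : state) : Prop :=
  count_inv r (endpoints (edge_list I)) s.

Definition ready (s : state) : Prop := b -> degrees_ready s.

Lemma ready_frame s s' vs : ready s -> memory s' = memory s ->
  (forall z, ~~ touched vs z -> regs s' z = regs s z) -> ready s'.
Proof.
move=> sI sm sr /sI[s1 s2 s3 s4].
by split; rewrite ?sm ?sr ?touched_const.
Qed.

Definition agree (vs : seq T) (f : {ffun T -> nat}) (s : state) : bool :=
  [forall t, (t \notin vs) ==> (f t == regs s (node_reg t))].

Lemma agreeP vs (f : {ffun T -> nat}) s :
  reflect (forall t, t \notin vs -> f t = regs s (node_reg t)) (agree vs f s).
Proof.
apply: (iffP forallP) => [H t tv|H t]; last by apply/implyP => /H ->.
by have /implyP/(_ tv)/eqP := H t.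
Qed.

Lemma agree_frame vs (f : {ffun T -> nat}) s s' :
  (forall z, ~~ touched vs z -> regs s' z = regs s z) ->
  agree vs f s' = agree vs f s.
Proof.
move=> sr; apply: eq_forallb => t.
by case: (boolP (t \in vs)) => //= tv; rewrite sr // touched_node_reg.
Qed.

(** The order of [fs] is left open, as the index lists come in any order; it is fixed as a
    duplicate-free set of assignments. Memory must be preserved because later loops read the degree
    table and the heavy list. *)
Definition spec_result (vs : seq T) (good : pred {ffun T -> nat})
    (run : runs n) (tau : nat) (s : state) : Prop :=
  exists t fs s',
    [/\ run s t (flatten (map out fs)) s', t <= tau,
        memory s' = memory s /\
        (forall z, ~~ touched vs z -> regs s' z = regs s z)
      & uniq fs /\ forall f, (f \in fs) = agree vs f s && good f].

Definition nodes_outside (vs : seq T) (s : state) : Prop :=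
  forall t, t \notin vs -> regs s (node_reg t) < n.

(* The loops of [c] run through the assignments that are [good] and extend the
   one held by the registers of the nodes outside [vs]. *)
Definition spec (vs : seq T) (good : pred {ffun T -> nat}) (c : cmd)
    (tau : nat) : Prop :=
  forall s, ready s -> nodes_outside vs s ->
    spec_result vs good (exec I c) tau s.

(** Shared by the [for] loops and the [while] loop over heavy nodes. [R l] is the run on the
    remaining elements [l], [L] ties the state to [l], [key a] lists the values that [a] puts into
    the registers of [xs], and [d] is the overhead per iteration. Distinct keys keep the assignments
    of different iterations distinct. *)
Lemma loop_spec (A : Type) (R : seq A -> runs n) (L : seq A -> state -> Prop)
    (xs : seq T) (key : A -> seq nat) vs good c tau d :
  spec vs good c tau ->
  {in xs, forall x, x \notin vs} ->
  (forall s, L [::] s -> R [::] s 1 [::] s) ->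
  (forall a l s, ready s -> L (a :: l) s -> exists s1,
    [/\ memory s1 = memory s, forall z, ~~ touched xs z -> regs s1 z = regs s z,
        map (regs s1 \o node_reg) xs = key a
      & forall t o s2, exec I c s1 t o s2 -> memory s2 = memory s1 ->
          (forall z, ~~ touched vs z -> regs s2 z = regs s1 z) ->
          L l s2 /\
          forall t' o' s3, R l s2 t' o' s3 ->
            exists2 k, k <= t + d + t' & R (a :: l) s k (o ++ o') s3]) ->
  forall l s, ready s -> L l s -> nodes_outside (xs ++ vs) s ->
  all (fun a => all (fun v => v < n) (key a)) l -> uniq (map key l) ->
  spec_result (xs ++ vs)
    (fun f => good f && (map f xs \in map key l)) (R l)
    (1 + size l * (tau + d)) s.
Proof.
move=> cS xsvs R0 R1; elim=> [|a l IH] s sI sL sn.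
  move=> _ _; exists 1, [::], s; split=> //; first exact: R0.
  by split=> // f; rewrite in_nil !andbF.
move=> /= /andP[an ln] /andP[al lu].
have [s1 [s1m s1r s1k s1R]] := R1 _ _ _ sI sL.
have s1r' z : ~~ touched (xs ++ vs) z -> regs s1 z = regs s z.
  by rewrite touched_cat negb_or => /andP[/s1r].
have s1n : nodes_outside vs s1.
  move=> t tvs; case: (boolP (t \in xs)) => tx.
    apply: (allP an); rewrite -s1k; exact: (map_f (regs s1 \o node_reg) tx).
  rewrite s1r ?touched_node_reg //; apply: sn.
  by rewrite mem_cat negb_or tx.
have s1I : ready s1 := ready_frame sI s1m s1r'.
have [t1 [fs1 [s2 [e1 t1le [s2m s2r] [fs1u fs1E]]]]] := cS _ s1I s1n.
have s2r' z : ~~ touched (xs ++ vs) z -> regs s2 z = regs s z.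
  move=> zt; rewrite -s1r' // s2r //.
  by move: zt; rewrite touched_cat negb_or => /andP[].
have [s2L s2R] := s1R _ _ _ e1 s2m s2r.
have s2I : ready s2 by apply: (ready_frame sI _ s2r'); rewrite s2m.
have s2n : nodes_outside (xs ++ vs) s2.
  by move=> t txv; rewrite s2r' ?touched_node_reg // sn.
have [t2 [fs2 [s3 [e2 t2le [s3m s3r] [fs2u fs2E]]]]] := IH s2 s2I s2L s2n ln lu.
have [k kle eR] := s2R _ _ _ e2.
(* The body extends exactly those assignments that take the values [key a] on [xs]. *)
have agreeE f : agree vs f s1 = agree (xs ++ vs) f s && (map f xs == key a).
  apply/agreeP/andP => [H|[/agreeP H /eqP K] t tvs].
    split; last first.
      rewrite -s1k; apply/eqP/eq_in_map => x /xsvs xv /=; exact: H.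
    apply/agreeP => t; rewrite mem_cat negb_or => /andP[tx tv].
    by rewrite H // s1r // touched_node_reg.
  case: (boolP (t \in xs)) => tx.
    by move: K; rewrite -s1k => /eq_in_map; apply.
  by rewrite H ?mem_cat ?negb_or ?tx // s1r // touched_node_reg.
exists k, (fs1 ++ fs2), s3; split.
- by rewrite map_cat flatten_cat.
- by nia.
- by rewrite s3m s2m s1m; split=> // z zt; rewrite s3r // s2r'.
split.
  rewrite cat_uniq fs1u fs2u andbT; apply/hasPn => f /=.
  rewrite fs2E fs1E agreeE => /and3P[_ _ fl].
  apply/negP => /andP[/andP[_ /eqP fa] _].
  by rewrite fa (negPf al) in fl.
move=> f; rewrite mem_cat fs1E fs2E agreeE inE (agree_frame _ s2r').
by case: (agree _ f s) => //=; case: (good f); rewrite ?andbF ?andbT.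
Qed.

(** The two conditions are compared only on assignments that agree with the registers, so values
    fixed by enclosing loops may be used. *)
Lemma eq_spec_result vs vs' good good' run tau tau' s :
  vs =i vs' -> (forall f, agree vs f s -> good f = good' f) -> tau <= tau' ->
  spec_result vs good run tau s -> spec_result vs' good' run tau' s.
Proof.
move=> vsE gE tauE [t [fs [s' [e tle [sm sr] [fu fE]]]]].
have tE z : touched vs z = touched vs' z.
  by rewrite /touched; congr (_ || _); apply: eq_has_r.
exists t, fs, s'; split=> //; first exact: leq_trans tauE.
  by split=> // z; rewrite -tE; apply: sr.
split=> // f; rewrite fE.
have -> : agree vs' f s = agree vs f s.
  by apply: eq_forallb => x; rewrite vsE.
by case: (boolP (agree vs f s)) => //= /gE.
Qed.

Lemma spec_seq vs g1 g2 c1 c2 tau1 tau2 :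
  spec vs g1 c1 tau1 -> spec vs g2 c2 tau2 -> (forall f, ~~ (g1 f && g2 f)) ->
  spec vs (fun f => g1 f || g2 f) (Seq c1 c2) (tau1 + tau2).
Proof.
move=> S1 S2 g12 s sI sn.
have [t1 [fs1 [s1 [e1 t1le [s1m s1r] [fs1u fs1E]]]]] := S1 _ sI sn.
have s1n : nodes_outside vs s1.
  by move=> t tv; rewrite s1r ?sn // touched_node_reg.
have [t2 [fs2 [s2 [e2 t2le [s2m s2r] [fs2u fs2E]]]]] :=
  S2 _ (ready_frame sI s1m s1r) s1n.
exists (t1 + t2), (fs1 ++ fs2), s2; split.
- do 5 eexists; split; [exact: e1|exact: e2|by []|].
  by rewrite map_cat flatten_cat.
- exact: leq_add.
- by rewrite s2m s1m; split=> // z zt; rewrite s2r // s1r.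
split=> [|f]; last first.
  by rewrite mem_cat fs1E fs2E (agree_frame _ s1r); case: agree.
rewrite cat_uniq fs1u fs2u andbT; apply/hasPn => f /=.
rewrite fs1E fs2E => /andP[_ g2f]; apply: contra (g12 f) => /andP[_ ->].
by rewrite g2f.
Qed.

Lemma for_spec (A : Type) (l : seq A) (bind : state -> A -> state)
    (xs : seq T) (key : A -> seq nat) vs good c tau s :
  spec vs good c tau ->
  {in xs, forall x, x \notin vs} ->
  (forall s a, [/\ memory (bind s a) = memory s,
     forall z, ~~ touched xs z -> regs (bind s a) z = regs s z
     & map (regs (bind s a) \o node_reg) xs = key a]) ->
  ready s -> nodes_outside (xs ++ vs) s ->
  all (fun a => all (fun v => v < n) (key a)) l -> uniq (map key l) ->
  spec_result (xs ++ vs)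
    (fun f => good f && (map f xs \in map key l)) (run_for bind (exec I c) l)
    (1 + size l * (tau + 1)) s.
Proof.
move=> cS xsvs bindE sI sn.
apply: (loop_spec (R := run_for bind (exec I c)) (L := fun _ _ => True) cS)
  => //.
  by move=> ? _; constructor.
move=> a l' s' _ _; exists (bind s' a); case: (bindE s' a) => bm br bk.
split=> // t o s2 e _ _; split=> // t' o' s3 e'.
exists (t + t').+1; first by rewrite addn1 addSn.
exact: run_for_cons e e'.
Qed.

(** * Correctness of each kind of step *)

Lemma upd_eq (f : nat -> nat) a v : upd f a v a = v.
Proof. by rewrite /upd eqxx. Qed.

Lemma upd_neq (f : nat -> nat) a v z : z != a -> upd f a v z = f z.
Proof. by rewrite /upd => /negPf ->. Qed.

Lemma touched1_neq x z : ~~ touched [:: x] z -> z != node_reg x.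
Proof. by apply: contra => /eqP ->; rewrite touched_node_reg mem_head. Qed.

Lemma spec_node x vs good c tau :
  x \notin vs -> spec vs good c tau ->
  spec (x :: vs) (fun f => (f x < n) && good f) (ForNode (node_reg x) c)
    (loop_time n tau).
Proof.
move=> xvs cS s sI sn.
pose key (v : nat) := [:: v].
have keyI : injective key by move=> u v [].
have : spec_result ([:: x] ++ vs)
    (fun f => good f && (map f [:: x] \in map key (iota 0 n)))
    (exec I (ForNode (node_reg x) c)) (1 + size (iota 0 n) * (tau + 1)) s.
  apply: for_spec => //.
  - by move=> ?; rewrite inE => /eqP ->.
  - move=> s' a; split=> //= [z /touched1_neq/upd_neq ->//|].
    by rewrite upd_eq.
  - by apply/allP => v; rewrite mem_iota /= andbT.
  - by rewrite map_inj_uniq ?iota_uniq.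
apply: eq_spec_result => // [f _|]; last by rewrite size_iota /loop_time; nia.
by rewrite -/(key (f x)) (mem_map keyI) mem_iota /= andbC.
Qed.

Definition listed (u v : nat) : bool :=
  [:: u; v] \in [seq [:: val e.1; val e.2] | e <- edge_list I].

Lemma listedP (u v : 'I_n) : listed u v = ((u, v) \in edge_list I).
Proof.
apply/mapP/idP => [[[i j] eI [/val_inj -> /val_inj ->]] //|uv].
by exists (u, v).
Qed.

Lemma listed_node u v : listed u v -> exists i j : 'I_n, u = i /\ v = j.
Proof. by case/mapP => e _ [-> ->]; exists e.1, e.2. Qed.

Lemma listed_adj u v : adj_query G u v = listed u v || listed v u.
Proof.
apply/adj_queryP/orP => [[i [j [<- <- ij]]]|].
  by apply/orP; rewrite !listedP -edge_list_orientation.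
case=> H; have [i [j [ui vj]]] := listed_node H; move: H.
  rewrite ui vj listedP => ij; exists i, j; split=> //.
  by rewrite (edge_list_orientation I) ij.
rewrite ui vj listedP => ij; exists j, i; split=> //.
by rewrite (edge_list_orientation I) ij orbT.
Qed.

Lemma listed_asym u v : ~~ (listed u v && listed v u).
Proof.
apply/negP => /andP[H]; have [i [j [ui vj]]] := listed_node H.
move: H; rewrite ui vj !listedP => ij; by rewrite (negPf (edge_list_asym ij)).
Qed.

Lemma touched2_neq x y z :
  ~~ touched [:: x; y] z -> (z != node_reg x) && (z != node_reg y).
Proof.
move=> zt; apply/andP; split; apply: contra zt => /eqP ->;
  by rewrite touched_node_reg !inE eqxx ?orbT.
Qed.

Lemma spec_for_edge x y vs good c tau :
  uniq [:: x, y & vs] -> spec vs good c tau ->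
  spec [:: x, y & vs] (fun f => good f && listed (f x) (f y))
    (ForEdge (node_reg x) (node_reg y) c) (1 + m * (tau + 1)).
Proof.
move=> /= /and3P[]; rewrite inE negb_or => /andP[xy xvs] yvs _ cS s sI sn.
apply: (for_spec (xs := [:: x; y]) (key := fun e => [:: val e.1; val e.2]) cS)
  => //.
- by move=> ?; rewrite !inE => /orP[] /eqP ->.
- move=> s' e; split=> //= [z /touched2_neq/andP[zx zy]|].
    by rewrite !upd_neq.
  by rewrite upd_eq upd_neq ?upd_eq // node_reg_eq.
- by apply/allP => e _ /=; rewrite !ltn_ord.
- rewrite map_inj_uniq ?edge_list_uniq_pairs //.
  by move=> [? ?] [? ?] /= [/val_inj -> /val_inj ->].
Qed.

Lemma spec_edge x y vs good c tau :
  uniq [:: x, y & vs] -> spec vs good c tau ->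
  spec [:: x, y & vs] (fun f => adj_query G (f x) (f y) && good f)
    (edge_code x y c) (loop_time m.*2 tau).
Proof.
move=> xyu cS.
have yxu : uniq [:: y, x & vs].
  by rewrite -(perm_uniq (s1 := [:: x, y & vs])) // (perm_catCA [:: x] [:: y]).
have vsE : [:: y, x & vs] =i [:: x, y & vs] by move=> z; rewrite !inE orbCA.
have S1 := spec_for_edge xyu cS.
have S2 : spec [:: x, y & vs] (fun f => good f && listed (f y) (f x))
    (ForEdge (node_reg y) (node_reg x) c) (1 + m * (tau + 1)).
  move=> s sI sn; apply: eq_spec_result (spec_for_edge yxu cS sI _) => //.
  by move=> t; rewrite vsE; apply: sn.
move=> s sI sn; apply: eq_spec_result (spec_seq S1 S2 _ sI sn) => //.
- by move=> f _; rewrite listed_adj; case: (good f); rewrite ?andbT ?andbF.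
- by rewrite /loop_time; nia.
by move=> f; rewrite andbACA andbb negb_and listed_asym orbT.
Qed.

Lemma spec_result_prefix vs good (run run' : runs n) tau d s s1 :
  memory s1 = memory s ->
  (forall z, ~~ touched vs z -> regs s1 z = regs s z) ->
  (forall t o s', run s1 t o s' -> run' s (d + t) o s') ->
  spec_result vs good run tau s1 -> spec_result vs good run' (d + tau) s.
Proof.
move=> s1m s1r H [t [fs [s' [e tle [sm sr] [fu fE]]]]].
exists (d + t), fs, s'; split; [exact: H|by rewrite leq_add2l| |].
  by rewrite sm s1m; split=> // z zt; rewrite sr // s1r.
by split=> // f; rewrite fE (agree_frame _ s1r).
Qed.

Lemma touched_tmp vs z : ~~ touched vs z -> z != tmp.
Proof. by apply: contra => /eqP ->. Qed.

(** An enclosing loop has bound [x], so its degree is a single memory cell; a heavy [x] is dismissed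
    in constant time, and a light one has at most [r] neighbours to try. *)
Lemma spec_light x z vs good c tau :
  b -> uniq [:: x, z & vs] -> spec vs good c tau ->
  spec (z :: vs)
    (fun f => [&& degree I (f x) <= r, adj_query G (f x) (f z) & good f])
    (light_code x z c) (loop_time r tau).
Proof.
move=> hb /= /and3P[xzvs zvs _] cS s sI sn.
have [_ s_thr s_deg _] := sI hb.
pose v := regs s (node_reg x).
pose s1 := set_reg (set_reg s tmp (v + v)) tmp (degree I v).
have s1r w : ~~ touched (z :: vs) w -> regs s1 w = regs s w.
  by move=> /touched_tmp wt; rewrite /s1 /= !upd_neq.
have xv f : agree (z :: vs) f s1 -> f x = v.
  by move=> /agreeP/(_ _ xzvs) ->; rewrite s1r // touched_node_reg.
have s1n : nodes_outside (z :: vs) s1.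
  by move=> t tv; rewrite s1r ?touched_node_reg // sn.
have e1 : exec I (Add tmp (node_reg x) (node_reg x)) s 1 [::]
    (set_reg s tmp (v + v)) by [].
have e2 : exec I (Read tmp tmp) (set_reg s tmp (v + v)) 1 [::] s1.
  have vv : memory s (v + v) = degree I v by rewrite addnn.
  by rewrite /= /run_basic /= upd_eq vv.
have testE : eval_test G (TLt thr tmp) s1 = (r < degree I v).
  by rewrite /= upd_eq !upd_neq // s_thr.
suff : spec_result (z :: vs)
    (fun f => [&& degree I (f x) <= r, adj_query G (f x) (f z) & good f])
    (exec I (if r < degree I v then Skip
             else ForNbr (node_reg z) (node_reg x) c))
    (1 + r * (tau + 1)) s1.
  move=> H; have : spec_result (z :: vs)
    (fun f => [&& degree I (f x) <= r, adj_query G (f x) (f z) & good f])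
    (exec I (light_code x z c)) (3 + (1 + r * (tau + 1))) s.
    apply: spec_result_prefix H => // t o s' e.
    exists 1, [::], (set_reg s tmp (v + v)), t.+2, o; split=> //.
    exists 1, [::], s1, t.+1, o; split=> //.
    by exists t => //; rewrite testE; move: e; case: ifP.
  by apply: eq_spec_result => //; rewrite /loop_time; nia.
case: ltnP => deg_v.
  exists 1, [::], s1; split=> //; split=> // f; rewrite in_nil.
  apply/esym/negP => /andP[/xv -> /and3P[]].
  by rewrite leqNgt deg_v.
pose key (w : nat) := [:: w].
have keyI : injective key by move=> u w [].
have s1x : regs s1 (node_reg x) = v by rewrite s1r ?touched_node_reg.
have : spec_result ([:: z] ++ vs)
    (fun f => good f && (map f [:: z] \in map key (nbr_query I v)))
    (exec I (ForNbr (node_reg z) (node_reg x) c))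
    (1 + size (nbr_query I v) * (tau + 1)) s1.
  apply: (@spec_result_prefix _ _ (run_for
    (fun s1 v => set_reg s1 (node_reg z) v) (exec I c) (nbr_query I v))
    _ _ 0 s1 s1) => // [t o s'|]; first by rewrite -s1x.
  apply: for_spec => //.
  - by move=> ?; rewrite inE => /eqP ->.
  - move=> s' a; split=> //= [w /touched1_neq/upd_neq ->//|].
    by rewrite upd_eq.
  - apply/allP => w; rewrite mem_nbr_query => /adj_queryP[? [j [_ <- _]]] /=.
    by rewrite ltn_ord.
  - by rewrite map_inj_uniq ?nbr_query_uniq.
apply: eq_spec_result => // [f /xv fx|].
  rewrite -/(key (f z)) (mem_map keyI) mem_nbr_query fx deg_v /= andbC.
  by [].
by rewrite leq_add2l leq_mul2r (leq_trans (size_nbr_query I v) deg_v) orbT.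
Qed.

Lemma spec_heavy x vs good c tau :
  b -> m < r.+1 ^ 2 -> x \notin vs -> spec vs good c tau ->
  spec (x :: vs) (fun f => (r < degree I (f x)) && good f) (heavy_code x c)
    (loop_time (3 * r) tau).
Proof.
move=> hb mr xvs cS s sI sn.
have [s_one _ _ [hv [hvu hvE s_top s_hv]]] := sI hb.
pose key (w : nat) := [:: w].
have keyI : injective key by move=> u w [].
(* From [size hv * (r+1) <= 2m <= 2r(r+2)] one gets [size hv < 2(r+1)], hence at most [3r] for
   positive [r]; for [r = 0] there are no edges and no heavy nodes. *)
have hv_le : size hv <= 3 * r.
  have : size hv * r.+1 <= size (endpoints (edge_list I)).
    by apply: size_over_threshold => // v; rewrite hvE.
  by rewrite size_endpoints -/m -mul2n; nia.
pose body := Seq (Read (node_reg x) (ctr_reg x))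
            (Seq (Add (ctr_reg x) (ctr_reg x) one)
            (Seq (Add (ctr_reg x) (ctr_reg x) one) c)).
(* [hv0] is the part of the heavy list already visited; the counter points just behind it. *)
pose L (l : seq nat) (s : state) := exists hv0,
  [/\ regs s (ctr_reg x) = (size hv0).*2.+1,
      regs s top = (size (hv0 ++ l)).*2.+1, regs s one = 1
    & forall i, i < size (hv0 ++ l) ->
        memory s i.*2.+1 = nth 0 (hv0 ++ l) i].
have loop s1 : ready s1 -> L hv s1 -> nodes_outside ([:: x] ++ vs) s1 ->
    spec_result ([:: x] ++ vs)
      (fun f => good f && (map f [:: x] \in map key hv))
      (exec I (While (TLt (ctr_reg x) top) body)) (1 + size hv * (tau + 4)) s1.
  move=> s1I s1L s1n.
  apply: (loop_spec (L := L)
    (R := fun _ => run_while G (TLt (ctr_reg x) top) (exec I body)) cS) => //.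
  - by move=> ?; rewrite inE => /eqP ->.
  - move=> s' [hv0 [sc st _ _]]; apply: run_while_false.
    by rewrite /= sc st cats0 ltnn.
  - move=> a l s' s'I [hv0 [sc st so sm]].
    pose i := size hv0.
    pose sa := set_reg s' (node_reg x) a.
    pose sb := set_reg sa (ctr_reg x) i.+1.*2.
    pose sd := set_reg sb (ctr_reg x) i.+1.*2.+1.
    exists sd; split=> //.
    + move=> z zt; rewrite /sd /= !upd_neq ?touched1_neq //;
      by apply: contra zt => /eqP ->; rewrite touched_ctr_reg mem_head.
    + by rewrite /sd /= 2?upd_neq ?upd_eq ?node_ctr_reg.
    move=> t o s2 e s2m s2r; split.
      exists (rcons hv0 a); rewrite cat_rcons; split.
      - by rewrite s2r ?touched_ctr_reg // /sd /= upd_eq size_rcons.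
      - rewrite s2r ?touched_const // -st /sd /= !upd_neq //;
        by rewrite /node_reg /ctr_reg; lia.
      - rewrite s2r ?touched_const // /sd /= !upd_neq //;
        by rewrite /node_reg /ctr_reg; lia.
      - by move=> j jl; rewrite s2m sm.
    move=> t' o' s3 e'; exists (3 + t + t').+1; first by lia.
    apply: run_while_true e'; first by rewrite /= sc st size_cat /=; lia.
    exists 1, [::], sa, t.+2, o; split=> //.
      by split=> //=; rewrite sc sm ?nth_cat ?ltnn ?subnn // size_cat /=; lia.
    have ne k : k < 10 -> k != node_reg x /\ k != ctr_reg x.
      by rewrite /node_reg /ctr_reg; lia.
    exists 1, [::], sb, t.+1, o; split=> //.
      split=> //=; rewrite !upd_neq ?so; try by case: (ne one).
        by rewrite sc addn1 /sb doubleS.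
      by rewrite eq_sym node_ctr_reg.
    exists 1, [::], sd, t, o; split=> //.
    split=> //=; rewrite upd_eq !upd_neq ?so ?addn1 //; by case: (ne one).
  - by apply/allP => v; rewrite hvE /= andbT => /degree_gt0_node.
  - by rewrite map_inj_uniq.
pose s1 := set_reg s (ctr_reg x) 1.
have s1r z : ~~ touched (x :: vs) z -> regs s1 z = regs s z.
  move=> zt; rewrite /s1 /= upd_neq //.
  by apply: contra zt => /eqP ->; rewrite touched_ctr_reg mem_head.
have s1n : nodes_outside (x :: vs) s1.
  by move=> t tv; rewrite s1r ?touched_node_reg // sn.
have s1L : L hv s1.
  exists [::]; split=> //; first by rewrite /s1 /= upd_eq.
  - by rewrite s1r ?touched_const.
  - by rewrite s1r ?touched_const.
have H := loop s1 (ready_frame sI (erefl : memory s1 = memory s) s1r) s1L s1n.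
have {}H : spec_result (x :: vs)
    (fun f => good f && (map f [:: x] \in map key hv))
    (exec I (heavy_code x c)) (1 + (1 + size hv * (tau + 4))) s.
  apply: spec_result_prefix H => // t o s' e.
  by exists 1, [::], s1, t, o.
apply: eq_spec_result H => // [f _|].
  by rewrite -/(key (f x)) (mem_map keyI) hvE andbC.
by rewrite /loop_time; nia.
Qed.

(** * Plans and sequences of plans *)

Definition plan_good (f : {ffun T -> nat}) (p : plan) : bool :=
  all (step_good^~ f) p.

Lemma spec_step st vs good c tau :
  (needs_degrees st -> b) -> (b -> m < r.+1 ^ 2) ->
  uniq (step_nodes st ++ vs) -> spec vs good c tau ->
  spec (step_nodes st ++ vs) (fun f => step_good st f && good f)
    (step_code st c) (step_time n m r st tau).
Proof.
case: st => [x|x y|x y z|x] hb mr vsu cS /=.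
- by apply: spec_node; case/andP: vsu.
- exact: spec_edge.
- have bT : b by exact: hb.
  have zS : spec (z :: vs)
      (fun f => [&& degree I (f x) <= r, adj_query G (f x) (f z) & good f])
      (light_code x z c) (loop_time r tau).
    apply: spec_light => //; move: vsu => /=.
    by rewrite !inE !negb_or => /and4P[/and3P[_ -> ->] _ -> ->].
  move=> s sI sn; apply: eq_spec_result (spec_edge vsu zS sI sn) => // f _.
  by rewrite -!andbA.
- have bT : b by exact: hb.
  by apply: spec_heavy => //; [exact: mr | case/andP: vsu].
Qed.

Lemma spec_plan (p : plan) good c tau :
  (has needs_degrees p -> b) -> (b -> m < r.+1 ^ 2) -> uniq (plan_nodes p) ->
  spec [::] good c tau ->
  spec (plan_nodes p) (fun f => plan_good f p && good f) (plan_code p c)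
    (plan_time n m r p tau).
Proof.
move=> + mr; elim: p => [|st p IH] //= hb pu cS.
have {}IH : spec (plan_nodes p) (fun f => plan_good f p && good f)
    (plan_code p c) (plan_time n m r p tau).
  apply: IH => // [h|]; first by apply: hb; rewrite h orbT.
  by move: pu; rewrite /plan_nodes /= cat_uniq => /and3P[].
have stb : needs_degrees st -> b by move=> h; apply: hb; rewrite h.
move=> s sI sn; apply: eq_spec_result (spec_step stb mr pu IH sI sn) => // f _.
by rewrite /plan_good /= -andbA.
Qed.

Definition covers (p : plan) : bool :=
  [&& has needs_degrees p ==> b, uniq (plan_nodes p)
    & [set x in plan_nodes p] == [set: T]].

Lemma exec_plans (ps : seq plan) c tau s :
  (b -> m < r.+1 ^ 2) -> all covers ps ->
  spec [::] predT c tau -> ready s ->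
  exists t fs s', [/\ exec I (plans_code ps c) s t (flatten (map out fs)) s',
    t <= sumn [seq plan_time n m r p tau | p <- ps] + 1
    & forall f, count_mem f fs = count (plan_good f) ps].
Proof.
move=> mr + cS; elim: ps s => [|p ps IH] s /= psC sI.
  by exists 1, [::], s.
case/andP: psC => /and3P[/implyP pb pu /eqP/setP pE] psC.
have pT : plan_nodes p =i predT by move=> x; have := pE x; rewrite !inE.
have sn : nodes_outside (plan_nodes p) s by move=> t; rewrite pT.
have [t1 [fs1 [s1 [e1 t1le [s1m s1r] [fs1u fs1E]]]]] :=
  spec_plan pb mr pu cS sI sn.
have [t2 [fs2 [s2 [e2 t2le fs2E]]]] :=
  IH s1 psC (ready_frame sI s1m s1r).
exists (t1 + t2), (fs1 ++ fs2), s2; split.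
- do 5 eexists; split; [exact: e1|exact: e2|by []|].
  by rewrite map_cat flatten_cat.
- by rewrite -addnA leq_add.
move=> f; rewrite count_cat fs2E (count_uniq_mem _ fs1u) fs1E andbT.
suff -> : agree (plan_nodes p) f s by [].
by apply/agreeP => t; rewrite pT.
Qed.

End Semantics.
End Programs.

(** * The innermost test *)

(** A full decision tree: [g] picks the command of each leaf while the program is being built. Any
    predicate of the test outcomes, such as canonicity, then costs only one branching per test. *)
Fixpoint decide (K : Type) (l : seq (K * test)) (g : seq K -> cmd) : cmd :=
  if l is (k, b) :: l' then
    If b (decide l' (fun ks => g (k :: ks))) (decide l' g)
  else g [::].

Lemma exec_decide n (G : sgraph 'I_n) (I : graph_index G) (K : Type)
    (l : seq (K * test)) g s t o s' :
  exec I (g [seq kb.1 | kb <- l & eval_test G kb.2 s]) s t o s' ->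
  exec I (decide l g) s (size l + t) o s'.
Proof.
elim: l g => [|[k b] l IH] g //= H; exists (size l + t) => //.
by move: H; case: ifP => _ /= H; apply: IH.
Qed.

Section FinalCheck.

Variables (T : finType) (S : sgraph T).

(* What comparing registers reveals about an assignment [f]: [(true, x, y)]
   stands for [f x < f y], and [(false, x, y)] for adjacency of [f x], [f y]. *)
Definition accept (K : {set bool * T * T}) : bool :=
  [&& [forall x, forall y,
         (x != y) ==> ((true, x, y) \in K) || ((true, y, x) \in K)],
      [forall x, forall y, adj S x y ==> ((false, x, y) \in K)]
    & canonical S (order_rank (fun y x => (true, y, x) \in K))].

Definition edge_pairs : {set T * T} := [set e | adj S e.1 e.2].

Definition check_tests : seq ((bool * T * T) * test) :=
  [seq (k, if k.1.1 then TLt (node_reg k.1.2) (node_reg k.2)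
           else TAdj (node_reg k.1.2) (node_reg k.2)) | k : bool * T * T].

Definition check_code : cmd :=
  decide check_tests (fun ks =>
    if accept [set k in ks] then
      Emit [seq node_reg t | t : T]
           [seq (node_reg e.1, node_reg e.2) | e in edge_pairs]
    else Skip).

Definition check_time : nat :=
  #|{: bool * T * T}| + (1 + #|T| + #|edge_pairs|).

Section Semantics.

Variables (n : nat) (G : sgraph 'I_n) (I : graph_index G).

Definition observations (f : T -> nat) : {set bool * T * T} :=
  [set k | if k.1.1 then f k.1.2 < f k.2 else adj_query G (f k.1.2) (f k.2)].

Lemma acceptP (f : T -> nat) :
  reflect [/\ injective f, forall x y, adj S x y -> adj_query G (f x) (f y)
            & canonical S (value_rank f)]
          (accept (observations f)).
Proof.
have rankE : order_rank (fun y x => (true, y, x) \in observations f)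
    = value_rank f.
  apply/ffunP => x; rewrite !ffunE; congr inord; apply: eq_card => y.
  by rewrite !inE.
rewrite /accept rankE; apply: (iffP and3P) => [[/forallP f1 /forallP f2 fc]|].
  split=> // [x y fxy|x y xy].
    apply/eqP/negP => /negP xy; have /forallP/(_ y)/implyP/(_ xy) := f1 x.
    by rewrite !inE /= fxy ltnn.
  by have /forallP/(_ y)/implyP/(_ xy) := f2 x; rewrite inE.
case=> finj fS fc; split=> //.
  apply/forallP => x; apply/forallP => y; apply/implyP => xy.
  by rewrite !inE /= -neq_ltn; apply: contra xy => /eqP/finj ->.
apply/forallP => x; apply/forallP => y; apply/implyP => xy.
by rewrite inE /=; apply: fS.
Qed.

Definition subgraph_of (f : T -> nat) : subgraph 'I_n :=
  ([set i | [exists t, val i == f t]],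
   [set [set i : 'I_n | (val i == f e.1) || (val i == f e.2)]
     | e in edge_pairs]).

Lemma subgraph_of_val (f : T -> nat) (g : T -> 'I_n) :
  (forall t, f t = g t) -> subgraph_of f = image_subgraph S g.
Proof.
move=> fg; congr pair.
  apply/setP => i; rewrite inE; apply/existsP/imsetP => [[t]|[t _ ->]].
    by rewrite fg => /eqP/val_inj ->; exists t.
  by exists t; rewrite fg.
by apply: eq_imset => e; apply/setP => i; rewrite !inE !fg.
Qed.

Definition check_output (f : {ffun T -> nat}) : seq (subgraph 'I_n) :=
  if accept (observations f) then [:: subgraph_of f] else [::].

Lemma spec_check r b :
  spec I r b check_output [::] predT check_code check_time.
Proof.
move=> s _ sn; pose f : {ffun T -> nat} := [ffun t => regs s (node_reg t)].
pose g t : 'I_n := Ordinal (sn t isT).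
have sub : subgraph_of f = image_subgraph S g.
  by apply: subgraph_of_val => t; rewrite ffunE.
have ksE : [set k in [seq kb.1 | kb <- check_tests & eval_test G kb.2 s]]
    = observations f.
  apply/setP => k; rewrite !inE /check_tests /image_mem filter_map -map_comp.
  rewrite map_id mem_filter mem_enum andbT /=.
  by case: k.1.1; rewrite /= !ffunE.
have [t tle e] : exists2 t, t <= 1 + #|T| + #|edge_pairs| &
    exec I (if accept (observations f) then
      Emit [seq node_reg t | t : T]
           [seq (node_reg e.1, node_reg e.2) | e in edge_pairs]
      else Skip) s t (check_output f) s.
  rewrite /check_output; case: ifP => _; last by exists 1.
  exists (1 + #|T| + #|edge_pairs|) => //.
  exists [seq g t | t : T], [seq (g e.1, g e.2) | e in edge_pairs].
  split=> //.
  - by rewrite -!map_comp; apply: eq_map.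
  - by rewrite -!map_comp; apply: eq_map.
  - rewrite sub; congr [:: (_, _)].
      apply/setP => i; rewrite inE.
      by apply/imsetP/imageP => -[t _ ->]; exists t.
    apply/setP => A; apply/imsetP/imsetP => [[e eS ->]|[_ /imageP[e eS ->] ->]].
      by exists (g e.1, g e.2) => //; apply: image_f.
    by exists e.
  - by rewrite !size_image.
exists (size check_tests + t), [:: f], s; split.
- rewrite /= cats0; apply: exec_decide; rewrite ksE; exact: e.
- by rewrite /check_time size_image leq_add2l.
- by [].
split=> // h; rewrite inE andbT; apply/eqP/agreeP => [-> u _|H].
  by rewrite ffunE.
by apply/ffunP => u; rewrite ffunE H.
Qed.

(** An instance is an orbit of embeddings under the automorphisms of [S]. Every embedding occurs
    once in [fs], and each orbit has exactly one member with a canonical rank pattern. *)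
Lemma outputs_spec (fs : seq {ffun T -> nat}) :
  (forall f, f \in fs -> forall t, f t < n) ->
  (forall g : T -> 'I_n, embedding S G g ->
     count_mem [ffun t => val (g t)] fs = 1) ->
  uniq (flatten (map check_output fs)) /\
  forall H, H \in flatten (map check_output fs) <-> is_instance S G H.
Proof.
move=> fsn fs1.
have -> : flatten (map check_output fs)
    = [seq subgraph_of f | f : {ffun T -> nat} <- fs & accept (observations f)].
  elim: (fs) => //= f l ->; rewrite /check_output.
  by case: (accept _).
pose F (g : T -> 'I_n) : {ffun T -> nat} := [ffun t => val (g t)].
have lift f : f \in fs -> accept (observations f) ->
    exists2 g, embedding S G g & [/\ f = F g, canonical S (value_rank f)
                                  & subgraph_of f = image_subgraph S g].
  move=> ffs /acceptP[finj fS fc].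
  pose g t : 'I_n := Ordinal (fsn f ffs t).
  exists g; last first.
    by split=> //; [apply/ffunP => t; rewrite ffunE | apply: subgraph_of_val].
  split=> [x y /(congr1 val) /= /finj //|x y /fS /adj_queryP[i [j [ix jy ij]]]].
  by rewrite (_ : g x = i) 1?(_ : g y = j) //; apply: val_inj.
split.
  rewrite map_inj_in_uniq.
    apply: count_mem_uniq => f; rewrite mem_filter.
    case: (boolP (accept _)) => /= fa; last first.
      apply/count_memPn; by rewrite mem_filter (negPf fa).
    rewrite count_filter (eq_count (a2 := pred1 f)); last first.
      by move=> h /=; case: eqP => //= ->.
    case: (boolP (f \in fs)) => [ffs|/count_memPn //].
    by have [g gS [fE _ _]] := lift f ffs fa; rewrite fE fs1.
  move=> f h; rewrite !mem_filter => /andP[fa ffs] /andP[ha hfs].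
  have [g [ginj _] [fE fc ->]] := lift f ffs fa.
  have [k [kinj _] [hE hc ->]] := lift h hfs ha => gk.
  have [u uA guk] := eq_image_subgraph ginj kinj gk.
  have hinj : injective h by case/acceptP: ha.
  have fhu : f =1 h \o u by move=> t; rewrite fE hE /F /= !ffunE guk.
  have E : value_rank f = [ffun t => value_rank h (u t)].
    rewrite -value_rank_perm; apply/ffunP => x; rewrite !ffunE.
    by congr inord; apply: eq_card => y; rewrite !inE !fhu.
  apply/ffunP => t; rewrite fhu /=; congr (h _).
  apply: (value_rank_inj hinj); apply: canonical_unique uA hc _ t.
  by rewrite -E.
move=> H; split.
  case/mapP => f; rewrite mem_filter => /andP[fa ffs] ->.
  have [g gS [_ _ ->]] := lift f ffs fa.
  by apply/instanceP; exists g.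
move=> /instanceP[g [ginj gS] ->].
have [u uA uc] := canonical_exists S (value_rank (fun t => val (g t))).
have kS : embedding S G (g \o u).
  split=> [x y /= /ginj/perm_inj //|x y xy /=]; apply: gS.
  by have /autsP -> := uA.
apply/mapP; exists (F (g \o u)); last first.
  rewrite -(image_subgraph_aut g uA); apply/esym/subgraph_of_val => t.
  by rewrite ffunE.
rewrite mem_filter; apply/andP; split; last first.
  by rewrite -has_pred1 has_count fs1.
apply/acceptP; split.
- by move=> x y; rewrite !ffunE => /val_inj; case: kS => kinj _ /kinj.
- move=> x y xy; apply/adj_queryP; exists (g (u x)), (g (u y)).
  by rewrite !ffunE; split=> //; apply: (proj2 kS).
move: uc; rewrite -value_rank_perm; congr (is_true (canonical _ _)).
apply/ffunP => x; rewrite !ffunE.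
by congr inord; apply: eq_card => y; rewrite !inE !ffunE.
Qed.

End Semantics.
End FinalCheck.

(** * Square root, degrees and heavy nodes *)

Section Preprocessing.

Variables (n : nat) (G : sgraph 'I_n) (I : graph_index G).

(** The loop-free commands of the preprocessing; [simulate] evaluates them, which reduces their
    verification to computation. *)
Fixpoint straight (c : cmd) : bool :=
  match c with
  | Skip | Const _ _ | Add _ _ _ | Read _ _ | Write _ _ => true
  | Seq c1 c2 | If _ c1 c2 => straight c1 && straight c2
  | _ => false
  end.

Fixpoint simulate (c : cmd) (s : state) : nat * state :=
  match c with
  | Const x k => (1, set_reg s x k)
  | Add x y z => (1, set_reg s x (regs s y + regs s z))
  | Read x y => (1, set_reg s x (memory s (regs s y)))
  | Write x y => (1, set_mem s (regs s x) (regs s y))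
  | Seq c1 c2 =>
      let: (t1, s1) := simulate c1 s in
      let: (t2, s2) := simulate c2 s1 in (t1 + t2, s2)
  | If b c1 c2 =>
      let: (t, s') :=
        if eval_test G b s then simulate c1 s else simulate c2 s in
      (t.+1, s')
  | _ => (1, s)
  end.

Lemma exec_straight c s : straight c ->
  exec I c s (simulate c s).1 [::] (simulate c s).2.
Proof.
elim: c s => //= [c1 IH1 c2 IH2|b c1 IH1 c2 IH2] s /andP[st1 st2].
  case E1: (simulate c1 s) => [t1 s1]; case E2: (simulate c2 s1) => [t2 s2].
  exists t1, [::], s1, t2, [::]; split=> //.
    by have := IH1 s st1; rewrite E1.
  by have := IH2 s1 st2; rewrite E2.
case: (eval_test G b s).
  case E: (simulate c1 s) => [t1 s1]; exists t1 => //.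
  by have := IH1 s st1; rewrite E.
case E: (simulate c2 s) => [t1 s1]; exists t1 => //.
by have := IH2 s st2; rewrite E.
Qed.

Lemma for_edge_inv (P : seq ('I_n * 'I_n) -> state -> Prop) x y c K :
  straight c ->
  (forall l (e : 'I_n * 'I_n) s, P l s ->
     let: (t, s') := simulate c (set_reg (set_reg s x (val e.1)) y (val e.2)) in
     t <= K /\ P (rcons l e) s') ->
  forall s, P [::] s -> exists t s',
    [/\ exec I (ForEdge x y c) s t [::] s',
        t <= 1 + size (edge_list I) * K.+1 & P (edge_list I) s'].
Proof.
move=> cs step s.
pose bind (s1 : state) (e : 'I_n * 'I_n) :=
  set_reg (set_reg s1 x (val e.1)) y (val e.2).
suff : forall l l0 s, P l0 s -> exists t s',
    [/\ run_for bind (exec I c) l s t [::] s', t <= 1 + size l * K.+1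
      & P (l0 ++ l) s'].
  by move=> /(_ (edge_list I) [::] s) H /H.
elim=> [|e l IH] l0 {}s Pl.
  by exists 1, s; rewrite cats0; split=> //; constructor.
have := step l0 e s Pl; rewrite -/(bind s e).
set s0 := bind s e; case E: (simulate c s0) => [t s1] [tle Ps1].
have [t' [s' [e' t'le Ps']]] := IH _ s1 Ps1.
exists (t + t').+1, s'; split; last by rewrite -cat_rcons.
  have e1 : exec I c s0 t [::] s1 by have := exec_straight s0 cs; rewrite E.
  exact: (run_for_cons e1 e').
by rewrite /= in t'le *; nia.
Qed.

Notation tmp := 0.
Notation val_tmp := 1.
Notation one := 2.
Notation thr := 3.
Notation top := 4.
Notation cnt := 6.
Notation next_sq := 7.

(** Keeps [next_sq] equal to the square of [thr + 1] by adding consecutive odd numbers: once [thr]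
    has become [r], [2r + 1] leads from the square of [r] to that of [r + 1]. *)
Definition sqrt_body : cmd :=
  Seq (Add cnt cnt one)
      (If (TEq cnt next_sq)
        (Seq (Add thr thr one)
        (Seq (Add next_sq next_sq thr)
        (Seq (Add next_sq next_sq thr) (Add next_sq next_sq one))))
        Skip).

(** A value enters the heavy list at the moment its count leaves [r], which happens at most once; so
    the list has no repetitions. *)
Definition bump (x : reg) : cmd :=
  Seq (Add tmp x x)
 (Seq (Read val_tmp tmp)
 (Seq (If (TEq val_tmp thr)
        (Seq (Write top x) (Seq (Add top top one) (Add top top one)))
        Skip)
 (Seq (Add val_tmp val_tmp one) (Write tmp val_tmp)))).

(** Two scans are needed: the threshold is known only after all edges have been counted. *)
Definition prep_code : cmd :=
  Seq (Const one 1)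
 (Seq (Const next_sq 1)
 (Seq (ForEdge 8 9 sqrt_body)
 (Seq (Const top 1) (ForEdge 8 9 (Seq (bump 8) (bump 9)))))).

Definition sqrt_inv (l : seq ('I_n * 'I_n)) (s : state) : Prop :=
  exists r, [/\ regs s one = 1 /\ (forall a, memory s a = 0), regs s thr = r,
    regs s cnt = size l, regs s next_sq = r.+1 ^ 2
    & r ^ 2 <= size l < r.+1 ^ 2].

Lemma sqrt_step l (e : 'I_n * 'I_n) s : sqrt_inv l s ->
  let: (t, s') :=
    simulate sqrt_body (set_reg (set_reg s 8 (val e.1)) 9 (val e.2)) in
  t <= 6 /\ sqrt_inv (rcons l e) s'.
Proof.
case=> r [[s1 sm] sr sc sq /andP[rl lr]] /=.
rewrite /upd /= sc s1 sq sr; case: eqP => [E|/eqP E] /=.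
  split=> //; exists r.+1.
  rewrite size_rcons; split; rewrite /= /upd /= ?sc ?s1 ?sq ?sr //.
  - by rewrite addn1.
  - by rewrite addn1.
  - by rewrite -!mulnn; lia.
  - by move: E rl lr; rewrite -!mulnn; nia.
split=> //; exists r.
rewrite size_rcons; split; rewrite /= /upd /= ?sc ?s1 ?sq ?sr ?addn1 //.
by move: E rl lr; rewrite -!mulnn; nia.
Qed.

(** Register 9 is tracked because the second [bump] of an edge still has to read its other end
    there. *)
Lemma bump_spec r l s x : x \in [:: 8; 9] -> count_inv r l s ->
  let: (t, s') := simulate (bump x) s in
  [/\ t <= 8, count_inv r (rcons l (regs s x)) s' & regs s' 9 = regs s 9].
Proof.
move=> x89 [s1 sr sm [hv [hvu hvE st sh]]].
set v := regs s x.
have cE u : count_mem u (rcons l v) = count_mem u l + (v == u).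
  by rewrite -cats1 count_cat /= addn0.
have dbl_inj (a c : nat) : (a.*2 == c.*2) = (a == c).
  by apply/eqP/eqP => [/double_inj|->].
have dbl_odd (a c : nat) : (a.*2 == c.*2.+1) = false by lia.
have main s' : regs s' one = 1 -> regs s' thr = r ->
    (forall a, memory s' a.*2 = memory s a.*2 + (v == a)) ->
    (if count_mem v l == r then
      regs s' top = (size hv).+1.*2.+1 /\
      (forall i, memory s' i.*2.+1 =
         if i == size hv then v else memory s i.*2.+1)
    else regs s' top = (size hv).*2.+1 /\
      (forall i, memory s' i.*2.+1 = memory s i.*2.+1)) ->
    count_inv r (rcons l v) s'.
  move=> s1' sr' sm' H; split=> // [a|]; first by rewrite sm' sm cE.
  move: H; case: eqP => vr [st' sh'].
    exists (rcons hv v); split.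
    - by rewrite rcons_uniq hvu hvE vr ltnn.
    - move=> u; rewrite mem_rcons inE hvE cE eq_sym; case: eqP => [<-|_] /=.
        by rewrite vr addn1 ltnSn.
      by rewrite addn0.
    - by rewrite size_rcons.
    - move=> i; rewrite size_rcons nth_rcons sh' => il.
      case: (ltngtP i (size hv)) => [ih|ih|//]; first exact: sh.
      by move: il; rewrite ltnS leqNgt ih.
  exists hv; split=> // [u|i ih]; last by rewrite sh' sh.
  rewrite hvE cE; case: eqP => [<-|_]; last by rewrite addn0.
  by rewrite addn1 ltnS [RHS]leq_eqVlt eq_sym (introF eqP vr).
have vE : regs s x = v by [].
rewrite /bump /=; move: x89; rewrite !inE => x89.
have [x0 [x1 x4]] : x != 0 /\ x != 1 /\ x != 4 by case/orP: x89 => /eqP ->.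
rewrite /upd /= (negPf x0) (negPf x1) vE addnn sm sr.
case: eqP => vr /=; split=> //; apply: main; rewrite /upd /= ?s1 ?st //.
- move=> a; rewrite /upd dbl_inj dbl_odd [v == a]eq_sym.
  by case: eqP => [->|_] /=; rewrite ?sm // addn0.
- rewrite vr eqxx /upd /= !addn1 doubleS; split=> // i.
  by rewrite eq_sym dbl_odd eqSS dbl_inj.
- move=> a; rewrite /upd dbl_inj [v == a]eq_sym.
  by case: eqP => [->|_] /=; rewrite ?sm // addn0.
rewrite (introF eqP vr) /upd /=; split=> // i.
by rewrite eq_sym dbl_odd.
Qed.

Lemma exec_prep : exists r t s,
  [/\ exec I prep_code init_state t [::] s,
      t <= 50 * (size (edge_list I)).+1,
      r ^ 2 <= size (edge_list I) < r.+1 ^ 2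
    & count_inv r (endpoints (edge_list I)) s].
Proof.
pose s0 := set_reg (set_reg init_state one 1) next_sq 1.
have s0_inv : sqrt_inv [::] s0 by exists 0.
have [t1 [s1 [e1 t1le [r [[s1o s1m] s1r s1c s1q rm]]]]] :=
  for_edge_inv (K := 6) (isT : straight sqrt_body) sqrt_step s0_inv.
pose s2 := set_reg s1 top 1.
have s2_inv : count_inv r (@endpoints n [::]) s2.
  split=> //=; last by exists [::].
have step l (e : 'I_n * 'I_n) s : count_inv r (endpoints l) s ->
    let: (t, s') := simulate (Seq (bump 8) (bump 9))
      (set_reg (set_reg s 8 (val e.1)) 9 (val e.2)) in
    t <= 16 /\ count_inv r (endpoints (rcons l e)) s'.
  move=> sI.
  set s3 := set_reg (set_reg _ _ _) _ _.
  have s3I : count_inv r (endpoints l) s3 by [].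
  rewrite [simulate _ _](_ : _ =
    let: (t, s4) := simulate (bump 8) s3 in
    let: (t', s5) := simulate (bump 9) s4 in (t + t', s5)) //.
  have := bump_spec (x := 8) isT s3I.
  case: (simulate (bump 8) s3) => t s4 [tle s4I s49].
  have := bump_spec (x := 9) isT s4I.
  case: (simulate (bump 9) s4) => t' s5 [t'le s5I _].
  split; first by lia.
  by rewrite endpoints_rcons; move: s5I; rewrite s49.
have [t2 [s3 [e2 t2le s3I]]] :=
  for_edge_inv (P := fun l => count_inv r (endpoints l)) (K := 16)
    (isT : straight (Seq (bump 8) (bump 9))) step s2_inv.
exists r, (1 + (1 + (t1 + (1 + t2)))), s3; split=> //; last by lia.
exists 1, [::], (set_reg init_state one 1), (1 + (t1 + (1 + t2))), [::].
split=> //; exists 1, [::], s0, (t1 + (1 + t2)), [::]; split=> //.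
exists t1, [::], s1, (1 + t2), [::]; split=> //.
by exists 1, [::], s2, t2, [::].
Qed.

End Preprocessing.

(** * Plans for a decomposition *)

Section Plans.

Variables (T : finType) (S : sgraph T).

Definition node_free (p : plan T) : bool :=
  all (fun st => if st is SNode _ then false else true) p.

Definition plan_ok (A : {set T}) (p : plan T) : bool :=
  [&& uniq (plan_nodes p), [set x in plan_nodes p] == A & node_free p].

(* Every homomorphism is found by exactly one of the plans. *)
Definition alternatives_ok (A : {set T}) (al : seq (plan T)) : Prop :=
  all (plan_ok A) al /\
  forall n (G : sgraph 'I_n) (I : graph_index G) r (f : {ffun T -> nat}),
    (forall x y, adj S x y -> adj_query G (f x) (f y)) ->
    count (plan_good I r f) al = 1.

Lemma plan_nodes_cons st (p : plan T) :
  plan_nodes (st :: p) = step_nodes st ++ plan_nodes p.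
Proof. by []. Qed.

Lemma plan_nodes_cat (p p' : plan T) :
  plan_nodes (p ++ p') = plan_nodes p ++ plan_nodes p'.
Proof. by rewrite /plan_nodes map_cat flatten_cat. Qed.

Lemma plan_ok_cat (A B : {set T}) p p' : [disjoint A & B] ->
  plan_ok A p -> plan_ok B p' -> plan_ok (A :|: B) (p ++ p').
Proof.
move=> AB /and3P[pu /eqP/setP pA pf] /and3P[pu' /eqP/setP pB pf'].
rewrite /plan_ok /node_free plan_nodes_cat cat_uniq all_cat pu pu'.
apply/and3P; split; last by apply/andP.
  rewrite andbT; apply/hasPn => x xp'; apply/negP => xp.
  by have := disjointFr AB (x := x); rewrite -pA -pB !inE xp xp' => /(_ isT).
by apply/eqP/setP => x; rewrite !inE mem_cat -pA -pB !inE.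
Qed.

Lemma all_allpairs_cat (al al' : seq (plan T)) (a a' c : pred (plan T)) :
  (forall p p', a p -> a' p' -> c (p ++ p')) ->
  all a al -> all a' al' -> all c [seq p ++ p' | p <- al, p' <- al'].
Proof.
move=> H + al'a; elim: al => //= p al IH /andP[pa ala].
rewrite all_cat IH // andbT all_map; apply: sub_all al'a => p' /=; exact: H.
Qed.

Lemma count_allpairs_cat (al al' : seq (plan T)) (a : pred (plan T)) :
  (forall p p', a (p ++ p') = a p && a p') ->
  count a [seq p ++ p' | p <- al, p' <- al'] = count a al * count a al'.
Proof.
move=> H; elim: al => //= p al IH; rewrite count_cat IH mulnDl count_map.
congr (_ + _); case ap: (a p).
  by rewrite mul1n; apply: eq_count => p' /=; rewrite H ap.
by rewrite mul0n -(count_pred0 al'); apply: eq_count => p' /=; rewrite H ap.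
Qed.

(** A combined plan is good when both halves are, so the numbers of good plans multiply and 1 times
    1 stays 1. *)
Lemma alternatives_cat (A B : {set T}) al al' : [disjoint A & B] ->
  alternatives_ok A al -> alternatives_ok B al' ->
  alternatives_ok (A :|: B) [seq p ++ p' | p <- al, p' <- al'].
Proof.
move=> AB [alA al1] [alB al1']; split.
  apply: all_allpairs_cat alA alB => p p'; exact: plan_ok_cat.
move=> n G I r f fS; rewrite count_allpairs_cat ?al1 ?al1' // => p p'.
exact: all_cat.
Qed.

Fixpoint pair_edges (s : seq T) : plan T :=
  if s is x :: y :: s' then SEdge x y :: pair_edges s' else [::].

Lemma plan_nodes_pair_edges s :
  ~~ odd (size s) -> plan_nodes (pair_edges s) = s.
Proof.
have [k] := ubnP (size s); elim: k s => // k IH [|x [|y s]] //= sk.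
rewrite negbK => so; rewrite -[in RHS](IH s) //; exact: ltnW.
Qed.

Lemma node_free_pair_edges s : node_free (pair_edges s).
Proof.
have [k] := ubnP (size s); elim: k s => // k IH [|x [|y s]] //= sk.
by apply: IH; apply: ltnW.
Qed.

Lemma plan_good_pair_edges n (G : sgraph 'I_n) (I : graph_index G) r
    (f : {ffun T -> nat}) s :
  (forall x y, adj S x y -> adj_query G (f x) (f y)) ->
  sorted (adj S) s -> plan_good I r f (pair_edges s).
Proof.
move=> fS; have [k] := ubnP (size s); elim: k s => // k IH [|x [|y s]] //= sk.
case/andP => xy ys; rewrite fS //=; apply: IH; first exact: ltnW.
exact: path_sorted ys.
Qed.

Lemma edge_alternatives B : edge_block S B -> exists al, alternatives_ok B al.
Proof.
move=> [x [y [xy ->]]]; exists [:: [:: SEdge x y]]; split=> /=.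
  rewrite /plan_ok /= inE !andbT; apply/andP; split.
    by apply: contraL xy => /eqP ->; rewrite adj_irr.
  by apply/eqP/setP => z; rewrite !inE.
by move=> n G I r f fS; rewrite fS.
Qed.

Lemma cycle_alternatives B :
  odd_hamiltonian_block S B -> exists al, alternatives_ok B al.
Proof.
move=> [[|a [|b s]] [s2 + /andP[]]] //.
case/lastP: s s2 => // mid z _ /=; rewrite size_rcons /= !negbK => midE.
rewrite rcons_path last_rcons /= => /andP[ab /andP[bz za]] su ->.
(* Odd length makes both [mid] and [b, mid, z] even, so either splits into consecutive pairs, which
   are edges of the cycle. *)
have bzE : ~~ odd (size (b :: rcons mid z)) by rewrite /= size_rcons /= negbK.
exists [:: SLight a b z :: pair_edges mid;
           SHeavy a :: pair_edges (b :: rcons mid z)]; split.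
  have abzE : perm_eq [:: a, b, z & mid] [:: a, b & rcons mid z].
    by rewrite !perm_cons perm_sym perm_rcons.
  apply/and3P; split=> //; apply/and3P; split.
  - rewrite plan_nodes_cons plan_nodes_pair_edges //.
    by rewrite [uniq _](perm_uniq abzE).
  - rewrite plan_nodes_cons plan_nodes_pair_edges //.
    by apply/eqP/setP => x; rewrite inE [LHS](perm_mem abzE) inE.
  - exact: node_free_pair_edges.
  - by rewrite plan_nodes_cons plan_nodes_pair_edges.
  - by rewrite plan_nodes_cons plan_nodes_pair_edges.
  - exact: (node_free_pair_edges (b :: rcons mid z)).
move=> n G I r f fS.
have midS : sorted (adj S) mid.
  by move: bz; rewrite rcons_path => /andP[/path_sorted].
have good_cons st p :
    plan_good I r f (st :: p) = step_good I r st f && plan_good I r f p by [].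
have count2 p p' : count (plan_good I r f) [:: p; p']
    = plan_good I r f p + plan_good I r f p' by rewrite /= addn0.
rewrite count2 !good_cons !plan_good_pair_edges //= !andbT.
rewrite [adj_query _ _ (f b)]fS // [adj_query _ _ (f z)]fS 1?adj_sym // andbT.
(* All adjacency conditions hold for a homomorphism; the degree of the image of [a] alone decides
   between the two plans. *)
by case: ltnP.
Qed.

Lemma blocks_alternatives (P : {set {set T}}) (l : seq {set T}) :
  trivIset P -> uniq l -> {subset l <= P} ->
  (forall B, B \in l -> edge_block S B \/ odd_hamiltonian_block S B) ->
  exists al, alternatives_ok [set x | has (fun B : {set T} => x \in B) l] al.
Proof.
move=> /trivIsetP tP; elim: l => [|B l IH] /=.
  move=> _ _ _; exists [:: [::]]; split=> //=.
  by rewrite /plan_ok /= !andbT; apply/eqP/setP => x; rewrite !inE.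
case/andP=> Bl lu lP lE.
have [al alE] : exists al, alternatives_ok B al.
  by case: (lE B (mem_head _ _)); [exact: edge_alternatives|
    exact: cycle_alternatives].
have [|C Cl|al' alE'] := IH lu _ _.
- by move=> C Cl; apply: lP; rewrite inE Cl orbT.
- by apply: lE; rewrite inE Cl orbT.
exists [seq p ++ p' | p <- al, p' <- al'].
have -> : [set x | (x \in B) || has (fun B : {set T} => x \in B) l]
    = B :|: [set x | has (fun B : {set T} => x \in B) l].
  by apply/setP => x; rewrite !inE.
apply: alternatives_cat => //; rewrite -setI_eq0; apply/eqP/setP => x.
rewrite !inE; apply/negP => /andP[xB /hasP[C Cl xC]].
have BC : [disjoint B & C].
  apply: tP; [exact/lP/mem_head| by apply: lP; rewrite inE Cl orbT|].
  by apply: contraNneq Bl => ->.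
by have := disjointFr BC xB; rewrite xC.
Qed.

(** [A] is the union of the blocks with more than one node. Its size being at least 2 when nonempty
    is what later lets [m^(#|A|/2)] pay for the linear preprocessing. *)
Lemma decomposition_plans (P : {set {set T}}) (q : nat) :
  odd_decomposition S P q ->
  exists A (xs : seq T) al,
    [/\ size xs = q, uniq xs, [set x in xs] = ~: A, A != set0 -> 1 < #|A|
      & alternatives_ok A al].
Proof.
move=> [/and3P[/eqP Pcov Ptriv P0] PB Pq].
pose l := enum [set B in P | #|B| != 1].
have lP : {subset l <= P} by move=> B; rewrite mem_enum inE => /andP[].
have lE B : B \in l -> edge_block S B \/ odd_hamiltonian_block S B.
  rewrite mem_enum inE => /andP[BP B1].
  by case: (PB B BP) => [/eqP|H|H]; [rewrite (negPf B1)|left|right].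
have [al alE] := blocks_alternatives Ptriv (enum_uniq _) lP lE.
exists [set x | has (fun B : {set T} => x \in B) l].
exists (enum [set x | [set x] \in P]), al.
split=> //.
- rewrite -cardE -Pq -(card_imset _ set1_inj); apply: eq_card => B.
  rewrite inE; apply/imsetP/andP => [[x + ->]|[BP /cards1P[x Bx]]].
    by rewrite inE cards1.
  by exists x; rewrite // inE -Bx.
- exact: enum_uniq.
- apply/setP => x; rewrite !inE mem_enum inE.
  apply/idP/hasPn => [xP B|H].
    rewrite mem_enum inE => /andP[BP B1]; apply/negP => xB.
    have := def_pblock Ptriv BP xB.
    rewrite (def_pblock Ptriv xP (set11 x)) => E.
    by rewrite -E cards1 in B1.
  have xc : x \in cover P by rewrite Pcov inE.
  have := H (pblock P x); rewrite mem_enum inE mem_pblock xc pblock_mem //.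
  case: (boolP (#|pblock P x| == 1)) => [/cards1P[y yE] _|_ /(_ isT) //].
  have : x \in pblock P x by rewrite mem_pblock.
  by rewrite yE inE => /eqP ->; rewrite -yE pblock_mem.
case/set0Pn => x; rewrite inE => /hasP[B Bl xB].
have : #|B| > 0 by apply/card_gt0P; exists x.
move: (Bl); rewrite mem_enum inE => /andP[_ B1] B0.
apply: (@leq_trans #|B|); first by rewrite ltn_neqAle eq_sym B1.
by apply/subset_leq_card/subsetP => y yB; rewrite inE; apply/hasP; exists B.
Qed.

End Plans.

(** * Running time *)

Section PlanTime.

Variable T : finType.

(** Both [5] and [5 * w] are at most [5 * (w * tau)], whence 11 = 5 + 5 + 1. *)
Lemma loop_time_le w tau : 0 < w -> 0 < tau ->
  loop_time w tau <= 11 * (w * tau).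
Proof. by rewrite /loop_time; nia. Qed.

Lemma step_time_gt0 n m r (st : step T) tau : 0 < step_time n m r st tau.
Proof. by case: st. Qed.

Lemma plan_time_gt0 n m r (p : plan T) tau :
  0 < tau -> 0 < plan_time n m r p tau.
Proof. by case: p => //= st p _; apply: step_time_gt0. Qed.

Lemma plan_time_cat n m r (p p' : plan T) tau :
  plan_time n m r (p ++ p') tau = plan_time n m r p (plan_time n m r p' tau).
Proof. exact: foldr_cat. Qed.

Lemma plan_time_nodes n m r (xs : seq T) tau : 0 < n -> 0 < tau ->
  plan_time n m r (map (@SNode T) xs) tau <= (11 * n) ^ size xs * tau.
Proof.
move=> n0 t0; elim: xs => [|x xs IH]; first by rewrite mul1n.
have := loop_time_le n0 (plan_time_gt0 n m r (map (@SNode T) xs) t0).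
move/leq_trans; apply; rewrite expnS.
by rewrite mulnA -[leqRHS]mulnA leq_mul2l IH orbT.
Qed.

Lemma plan_time_nodes0 m r (xs : seq T) tau :
  plan_time 0 m r (map (@SNode T) xs) tau <= 5 + tau.
Proof. by case: xs => [|x xs] /=; rewrite ?leq_addl // leq_addr. Qed.

(** The outermost loop is empty, whatever the time [tau] of its interior; this serves data graphs
    without edges, where the allowed time is constant. *)
Lemma plan_time_no_edges n (p : plan T) tau :
  node_free p -> plan_nodes p != [::] -> plan_time n 0 0 p tau <= 5.
Proof. by case: p => [//|[] //]. Qed.

Lemma node_free_nil (p : plan T) :
  node_free p -> plan_nodes p = [::] -> p = [::].
Proof. by case: p => [|[] //]. Qed.

Local Open Scope ring_scope.

(** With [x] the real square root of [m], a step costs at most a factor [242 * x] per node it binds.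
    The constant comes from the light step, two nested loops over [2m] edges and [r] neighbours: 242
    = 11 * 2 * 11. *)
Lemma plan_time_node_free (R : realType) n m r (p : plan T) tau (x : R) :
  (0 < r)%N -> (0 < m)%N -> (0 < tau)%N ->
  1 <= x -> m%:R = x ^+ 2 -> r%:R <= x -> node_free p ->
  (plan_time n m r p tau)%:R <= (242 * x) ^+ size (plan_nodes p) * tau%:R.
Proof.
move=> r0 m0 t0 x1 mx rx; elim: p => [|st p IH] pf; first by rewrite mul1r.
have {}IH : (plan_time n m r p tau)%:R <=
    (242 * x) ^+ size (plan_nodes p) * tau%:R by apply: IH; case/andP: pf.
have x0 : 0 <= x by apply: le_trans x1.
have P0 := plan_time_gt0 n m r p t0.
rewrite plan_nodes_cons size_cat exprD -mulrA /=.
set t := plan_time n m r p tau in IH P0 *.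
apply: (@le_trans _ _ ((242 * x) ^+ size (step_nodes st) * t%:R)); last first.
  by apply: ler_wpM2l => //; apply: exprn_ge0; apply: mulr_ge0.
have m2 : (0 < m.*2)%N by rewrite double_gt0.
have rx' : r%:R * t%:R <= x * t%:R by apply: ler_wpM2r.
have t0' : 0 <= t%:R :> R by [].
case: st pf => //= [u v|u v w|u] _.
- apply: (@le_trans _ _ (11 * (m.*2 * t))%:R).
    by rewrite ler_nat loop_time_le.
  by rewrite -mul2n !natrM mx; nra.
- apply: (@le_trans _ _ (11 * (m.*2 * (11 * (r * t))))%:R).
    rewrite ler_nat; apply: leq_trans (loop_time_le _ _) _ => //.
    by rewrite !leq_mul2l /= loop_time_le ?orbT.
  rewrite -mul2n !natrM mx.
  have : x ^+ 2 * (r%:R * t%:R) <= x ^+ 2 * (x * t%:R).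
    by apply: ler_wpM2l => //; apply: exprn_ge0.
  have : 0 <= x ^+ 2 * (x * t%:R) by rewrite !mulr_ge0 // exprn_ge0.
  by rewrite !exprMn !exprS; nra.
apply: (@le_trans _ _ (11 * (3 * r * t))%:R).
  by rewrite ler_nat loop_time_le // muln_gt0.
by rewrite !natrM; nra.
Qed.

Lemma powR_half_nat (R : realType) (a : R) k :
  0 <= a -> a `^ (k%:R / 2) = Num.sqrt a ^+ k.
Proof.
by move=> a0; rewrite mulrC powRrM powR12_sqrt // powR_mulrn // sqrtr_ge0.
Qed.

End PlanTime.

Lemma step_good_lt (T : finType) n (G : sgraph 'I_n) (I : graph_index G) r
    (f : {ffun T -> nat}) st x :
  step_good I r st f -> x \in step_nodes st -> f x < n.
Proof.
case: st => /= [u|u v|u v w|u].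
- by rewrite inE => fu /eqP ->.
- case/adj_queryP => i [j [iu jv _]].
  by rewrite !inE => /orP[] /eqP ->; rewrite -?iu -?jv ltn_ord.
- case/and3P => /adj_queryP[i [j [iu jv _]]] _ /adj_queryP[_ [k [_ kw _]]].
  by rewrite !inE => /or3P[] /eqP ->; rewrite -?iu -?jv -?kw ltn_ord.
- by rewrite inE => /degree_gt0_node fu /eqP ->.
Qed.

Lemma plan_good_lt (T : finType) n (G : sgraph 'I_n) (I : graph_index G) r
    (f : {ffun T -> nat}) p x :
  plan_good I r f p -> x \in plan_nodes p -> f x < n.
Proof.
elim: p => //= st p IH /andP[sf pf]; rewrite plan_nodes_cons mem_cat.
by case/orP => [/(step_good_lt sf)|/(IH pf)].
Qed.

(** * The complete program *)

Section Enumeration.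

Variables (T : finType) (S : sgraph T).

Definition enum_code (b : bool) (ps : seq (plan T)) : cmd :=
  Seq (if b then prep_code else Skip) (plans_code ps (check_code S)).

Lemma enum_code_correct b (ps : seq (plan T)) n (G : sgraph 'I_n)
    (I : graph_index G) :
  all (@covers T b) ps ->
  (forall r (f : {ffun T -> nat}), (forall x, f x < n) ->
     (forall x y, adj S x y -> adj_query G (f x) (f y)) ->
     count (plan_good I r f) ps = 1) ->
  exists r t out s,
    [/\ exec I (enum_code b ps) init_state t out s, uniq out,
        forall H, H \in out <-> is_instance S G H,
        b -> r ^ 2 <= #|edges G| < r.+1 ^ 2
      & t <= (if b then 50 * #|edges G|.+1 else 1) +
        (sumn [seq plan_time n #|edges G| r p (check_time S) | p <- ps] + 1)].
Proof.
move=> psC ps1; rewrite -(size_edge_list I).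
have [r [t0 [s0 [e0 t0le rm s0I]]]] : exists r t s,
    [/\ exec I (if b then prep_code else Skip) init_state t [::] s,
        t <= (if b then 50 * (size (edge_list I)).+1 else 1),
        b -> r ^ 2 <= size (edge_list I) < r.+1 ^ 2
      & ready I r b s].
  case: b {psC} => [|]; last by exists 0, 1, init_state.
  by have [r [t [s [? ? ? ?]]]] := exec_prep I; exists r, t, s; split.
have mr : b -> size (edge_list I) < r.+1 ^ 2 by move=> /rm/andP[].
have [t1 [fs [s1 [e1 t1le fsE]]]] :=
  exec_plans mr psC (@spec_check T S n G I r b) s0I.
have fs_lt f : f \in fs -> forall t, f t < n.
  rewrite -has_pred1 has_count fsE -has_count.
  elim: (ps) psC => //= pl l IH /andP[/and3P[_ _ /eqP/setP plT] lC].
  case/orP => [plf t|/(IH lC)//]; apply: plan_good_lt plf _.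
  by have := plT t; rewrite !inE.
have fs1 (g : T -> 'I_n) : embedding S G g ->
    count_mem [ffun t => val (g t)] fs = 1.
  move=> [_ gS]; rewrite fsE; apply: ps1 => [x|x y xy];
    rewrite !ffunE ?ltn_ord //.
  by apply/adj_queryP; exists (g x), (g y); split=> //; apply: gS.
have [out_uniq outE] := outputs_spec fs_lt fs1.
exists r, (t0 + t1), (flatten (map (check_output S G) fs)), s1; split=> //.
  by exists t0, [::], s0, t1, (flatten (map (check_output S G) fs)).
exact: leq_add.
Qed.

End Enumeration.

(** * The bound on the total running time *)

Local Open Scope ring_scope.

Theorem theorem7p2 (R : realType) (T : finType) (S : sgraph T) (p q : nat) :
  #|T| = p ->
  (exists P : {set {set T}}, odd_decomposition S P q) ->
  has_algorithm S (q%:R : R) ((p%:R - q%:R) / 2).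
Proof.
move=> <- [P /decomposition_plans[A [xs [al [xsq xsu xsA A1 [alA al1]]]]]].
have qA : (#|A| + q = #|T|)%N.
  by rewrite -(cardsC A) -xsA cardsE -xsq (card_uniqP xsu).
have qE : #|T|%:R - q%:R = #|A|%:R :> R by rewrite -qA natrD addrK.
rewrite qE; split; rewrite ?divr_ge0 //.
pose b := A != set0; pose tau := check_time S.
(* The node loops come last, that is innermost. *)
pose ps := [seq pl ++ map (@SNode T) xs | pl <- al].
have xs_nodes : plan_nodes (map (@SNode T) xs) = xs.
  by elim: (xs) => //= x l; rewrite plan_nodes_cons => ->.
have psC : all (@covers T b) ps.
  rewrite /ps all_map; apply: sub_all alA => pl /and3P[plu /eqP plA plf] /=.
  rewrite /covers plan_nodes_cat xs_nodes has_cat; apply/and3P; split.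
  - apply/implyP => /orP[hpl|]; last by rewrite has_map; case/hasP.
    rewrite /b -plA; apply/set0Pn; case: pl hpl {plu plA plf} => // st pl _.
    by case: st => [u|u v|u v w|u]; exists u;
      rewrite inE plan_nodes_cons mem_head.
  - rewrite cat_uniq plu xsu andbT; apply/hasPn => x xxs; apply/negP => xpl.
    have : x \in [set y in xs] by rewrite inE.
    by rewrite xsA -plA !inE xpl.
  - apply/eqP/setP => x; rewrite !inE mem_cat.
    have -> : (x \in xs) = (x \in ~: A) by rewrite -xsA inE.
    have -> : (x \in plan_nodes pl) = (x \in A) by rewrite -plA inE.
    by rewrite inE; case: (x \in A).
(* One factor per kind of loop, each raised to [#|T|] to dominate the actual number of bound nodes;
   [5 + tau] also covers the runs whose outermost loop is empty. *)
pose K : R := (242 ^+ #|T| * 11 ^+ #|T| * (5 + tau%:R)).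
(* 100 pays for the preprocessing, since [50(m+1)] is at most 100 times the bound; the remaining 2
   more than cover the final [Skip]. *)
exists (enum_code S b ps), (102 + (size al)%:R * K) => n G I.
have [|r [t [out [s [e outu outE rm tle]]]]] :=
  enum_code_correct (S := S) (I := I) psC.
  move=> r f fn fS; rewrite /ps count_map -(al1 n G I r f fS); apply: eq_count.
  move=> pl; rewrite /= /plan_good all_cat.
  rewrite [X in _ && X](_ : _ = true) ?andbT //.
  by elim: (xs) => //= x l ->; rewrite fn.
exists t, out, s; split=> //.
set m := #|edges G| in rm tle *.
rewrite powR_half_nat // powR_mulrn //.
set x := Num.sqrt m%:R.
set M := Num.max 1 _.
have M1 : 1 <= M by rewrite le_max lexx.
have Mge : n%:R ^+ q * x ^+ #|A| <= M by rewrite le_max lexx orbT.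
have x0 : 0 <= x := sqrtr_ge0 _.
have xm : m%:R = x ^+ 2 by rewrite sqr_sqrtr.
have tau0 : (0 < tau)%N.
  by rewrite /tau /check_time addnA addn_gt0 addn_gt0 orbT.
have K1 : 1 <= 242 ^+ #|T| :> R by rewrite exprn_ege1 ?ler1n.
have K2 : 1 <= 11 ^+ #|T| :> R by rewrite exprn_ege1 ?ler1n.
have K0 : 5 + tau%:R <= K.
  have : 1 <= 242 ^+ #|T| * 11 ^+ #|T| :> R by rewrite mulr_ege1.
  have : 0 <= 5 + tau%:R :> R by rewrite addr_ge0.
  by rewrite /K; nra.
have K_ge0 : 0 <= K by apply: le_trans K0; rewrite addr_ge0.
have n0 : (0 < m)%N -> (0 < n)%N.
  rewrite card_gt0 => /set0Pn[B /edgesP[u _]]; exact: leq_ltn_trans (ltn_ord u).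
have b_large : b -> (0 < m)%N -> [/\ (0 < r)%N, 1 <= x & r%:R <= x].
  move=> bT m0; have /andP[rm1 rm2] := rm bT; split.
  - by case: (r) rm2 => //; rewrite ltnNge m0.
  - by rewrite -sqrtr1 ler_wsqrtr // ler1n.
  by rewrite -(@ler_pXn2r _ 2) ?nnegrE // -xm -natrX ler_nat.
have nq1 : (0 < n)%N -> 1 <= n%:R ^+ q :> R.
  by move=> n1; rewrite exprn_ege1 // ler1n.
have pre_le : (if b then 50 * m.+1 else 1)%N%:R <= 100 * M.
  case: ifP => bT; last by lra.
  case: (posnP m) => [->|m0]; first by rewrite muln1; lra.
  have [_ x1 _] := b_large bT m0.
  (* An edge forces [n] to be positive, and [#|A|] is at least 2, so [m] itself is below the
     bound. *)
  have : x ^+ 2 <= n%:R ^+ q * x ^+ #|A|.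
    have : x ^+ 2 <= x ^+ #|A| by apply: ler_weXn2l => //; apply: A1.
    have : 1 <= x ^+ #|A| by apply: exprn_ege1.
    have := nq1 (n0 m0); nra.
  have : 1 <= x ^+ 2 by apply: exprn_ege1.
  by rewrite -xm natrM -addn1 natrD; lra.
have plan_le pl : plan_ok A pl ->
    (plan_time n m r (pl ++ map (@SNode T) xs) tau)%:R <= K * M.
  case/and3P => plu /eqP plA plf; rewrite plan_time_cat.
  have plA' : size (plan_nodes pl) = #|A|.
    by rewrite -plA cardsE (card_uniqP plu).
  (* For the degenerate cases, where only [1 <= M] is available. *)
  have small k : (k <= 5 + tau)%N -> k%:R <= K * M.
    rewrite -(ler_nat R) natrD => kle.
    by apply: le_trans kle (le_trans K0 _); rewrite ler_peMr.
  have nodes_le : (0 < n)%N -> (plan_time n m r (map (@SNode T) xs) tau)%:R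
      <= 11 ^+ #|T| * (n%:R ^+ q * tau%:R) :> R.
    move=> n1; apply: (@le_trans _ _ ((11 * n) ^ size xs * tau)%:R).
      by rewrite ler_nat plan_time_nodes.
    rewrite natrM natrX natrM xsq exprMn -mulrA ler_wpM2r //.
      by rewrite mulr_ge0 // exprn_ge0.
    by apply: ler_weXn2l; rewrite ?ler1n // -qA leq_addl.
  pose N : R := n%:R ^+ q.
  have N0 : 0 <= N by apply: exprn_ge0.
  have finish (y : R) : 0 <= y -> y * N <= M ->
      242 ^+ #|T| * y * (11 ^+ #|T| * (N * tau%:R)) <= K * M.
    move=> y0 yM; apply: (@le_trans _ _ (K * (y * N))); last exact: ler_wpM2l.
    have -> : 242 ^+ #|T| * y * (11 ^+ #|T| * (N * tau%:R))
        = 242 ^+ #|T| * 11 ^+ #|T| * tau%:R * (y * N) by ring.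
    apply: ler_wpM2r; first exact: mulr_ge0.
    by apply: ler_wpM2l; rewrite ?lerDr // mulr_ge0 // exprn_ge0.
  have [bT|bF] := boolP b; last first.
    have A0 : A = set0 by apply/eqP; rewrite -[_ == _]negbK.
    have -> : pl = [::].
      by apply: node_free_nil => //; apply: size0nil; rewrite plA' A0 cards0.
    case: (posnP n) => [->|n1].
      by apply: small; apply: plan_time_nodes0.
    have N_M : 1 * N <= M by move: Mge; rewrite A0 cards0 mulr1 mul1r.
    apply: le_trans (nodes_le n1) (le_trans _ (finish 1 ler01 N_M)).
    by rewrite mulr1 ler_peMl // mulr_ge0 ?exprn_ge0 // mulr_ge0.
  have pl0 : plan_nodes pl != [::].
    by rewrite -size_eq0 plA' -lt0n; apply: leq_ltn_trans (A1 bT).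
  case: (posnP m) => [m0|m0].
    have r0 : r = 0%N.
      by have /andP[+ _] := rm bT; rewrite m0 leqn0 expn_eq0 andbT => /eqP.
    apply: small; rewrite m0 r0.
    by rewrite (leq_trans (plan_time_no_edges _ _ _ _)) ?leq_addr.
  have [r0 x1 rx] := b_large bT m0.
  have tau1 := plan_time_gt0 n m r (map (@SNode T) xs) tau0.
  apply: le_trans (plan_time_node_free n r0 m0 tau1 x1 xm rx plf) _.
  have xA_M : x ^+ #|A| * N <= M by rewrite mulrC.
  apply: le_trans (finish _ (exprn_ge0 _ x0) xA_M).
  rewrite plA' exprMn; apply: ler_pM; rewrite ?mulr_ge0 ?exprn_ge0 //.
    apply: ler_wpM2r; first exact: exprn_ge0.
    by apply: ler_weXn2l; rewrite ?ler1n // -qA leq_addr.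
  exact/nodes_le/n0.
have sum_le : (sumn [seq plan_time n m r p0 tau | p0 <- ps])%:R
    <= (size al)%:R * K * M.
  rewrite /ps; elim: (al) alA => [|pl l IH] /=; first by rewrite !mul0r.
  case/andP=> /plan_le H /IH {}IH; rewrite natrD -addn1 natrD.
  by rewrite [_ + 1]addrC !mulrDl mul1r lerD.
have : t%:R <= (if b then 50 * m.+1 else 1)%N%:R +
    ((sumn [seq plan_time n m r p0 tau | p0 <- ps])%:R + 1) :> R.
  by move: tle; rewrite -(ler_nat R) !natrD.
move: pre_le sum_le; lra.
Qed.
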